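(* Let $\nu>0$, $d\ge1$, and let $u$ be the solution of $$\partial_tu=\nu^2\Delta u-\Pi_N(u^3-u),\quad (t,x)\in(0,\infty)\times\mathbb T^d,\qquad u|_{t=0}=\Pi_Nu_0.$$ The following hold. (1) (Effective maximum principle for regular initial data) Assume $\|u_0\|_\infty\le1$ and $u_0\in H^s(\mathbb T^d)$, $s>\frac d2$. Then for $N\ge N_0=N_0(s,d,\nu,u_0)$, $$\sup_{0\le t<\infty}\|u(t,\cdot)\|_\infty\le1+N^{-\gamma_0}C_1,$$ where $\gamma_0=\min\{s-\frac d2,1\}$ and $C_1>0$ depends only on $(s,d,\nu,u_0)$. (2) (Effective maximum principle for $L^\infty$ initial data) Assume $\|u_0\|_\infty\le1$. Then for $N\ge N_1=N_1(d,\nu,u_0)$, $$\sup_{0\le t<\infty}\|u(t,\cdot)\|_\infty\le\max\{\|\Pi_Nu_0\|_\infty,1\}+N^{-\frac12}C_2,$$ where $C_2>0$ depends only on $(d,\nu,u_0)$.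
   Context: $\mathbb T^d=[0,1)^d$ with periodic boundary conditions; functions are real-valued. $\Pi_N$ is the Fourier projection onto modes $e^{2\pi ik\cdot x}$, $k\in\mathbb Z^d$, with $|k|_\infty=\max_j|k_j|\le N$. $\|\cdot\|_\infty$ is the $L^\infty(\mathbb T^d)$ norm. *)

(* Defs.v *)
From HB Require Import structures.
From mathcomp Require Import all_boot all_order all_algebra.
From mathcomp Require Import all_classical all_reals all_analysis.
From mathcomp Require Import complex.

Set Implicit Arguments.
Unset Strict Implicit.
Unset Printing Implicit Defensive.

Import Order.TTheory GRing.Theory Num.Theory.
Import numFieldNormedType.Exports.

Local Open Scope classical_set_scope.
Local Open Scope ring_scope.

Section torus_measure.
Context (R : realType).

Definition unit_measure : set (measurableTypeR R) -> \bar R :=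
  mrestr (@lebesgue_measure R) (measurable_itv (`[0, 1[ : interval R)).

HB.instance Definition _ := Measure.on unit_measure.

Let unit_measure_setT : unit_measure [set: measurableTypeR R] = 1%E.
Proof.
rewrite /unit_measure /mrestr setTI lebesgue_measure_itv /= lte01.
by rewrite oppr0 adde0.
Qed.

HB.instance Definition _ :=
  Measure_isProbability.Build _ _ _ unit_measure unit_measure_setT.

Definition tcons (d : nat)
    (p : measurableTypeR R * d.-tuple (measurableTypeR R)) :
    d.+1.-tuple (measurableTypeR R) :=
  [tuple of p.1 :: p.2].

Lemma measurable_tcons d : measurable_fun [set: _] (@tcons d).
Proof. by apply: measurable_cons. Qed.

HB.instance Definition _ d :=
  isMeasurableFun.Build _ _ _ _ (@tcons d) (@measurable_tcons d).

(* The d-dimensional Lebesgue measure of [0, 1)^d. The library has the product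
   sigma-algebra on d-tuples but no measure on it, hence the recursion. *)
Fixpoint torus_measure (d : nat) :
    probability (d.-tuple (measurableTypeR R)) R :=
  match d with
  | 0 => \d_([tuple] : 0.-tuple (measurableTypeR R))
  | d.+1 => distribution (unit_measure \x torus_measure d)%E (@tcons d)
  end.

End torus_measure.

Section torus_functions.
Context (R : realType) (d : nat).
Implicit Types (f g : 'rV[R]_d -> R) (k : 'rV[int]_d) (x : 'rV[R]_d) (N : nat).

(* A function on the torus is a function on R^d that is 1-periodic in each
   variable. *)
Definition torus_periodic f :=
  forall x (i : 'I_d), f (x + delta_mx 0 i) = f x.

Definition row_of (y : d.-tuple (measurableTypeR R)) : 'rV[R]_d :=
  \row_i tnth y i.

Definition torus_measurable f :=
  measurable_fun [set: d.-tuple (measurableTypeR R)]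
    (fun y => f (row_of y) : measurableTypeR R).

Definition Linfty_norm f : \bar R :=
  ('N[@torus_measure R d]_(+oo) [ (fun y => (f (row_of y))%:E) ])%E.

Definition torus_int f : R :=
  \int[@torus_measure R d]_y f (row_of y).

Definition torus_cint (h : 'rV[R]_d -> R[i]) : R[i] :=
  Complex (torus_int (fun x => complex.Re (h x)))
          (torus_int (fun x => complex.Im (h x))).

Definition dotZ k x : R := \sum_i (k 0 i)%:~R * x 0 i.

(* e^{2 pi i k.x} *)
Definition fourier_mode k x : R[i] :=
  Complex (cos (2 * pi * dotZ k x)) (sin (2 * pi * dotZ k x)).

Definition fourier_coef f k : R[i] :=
  torus_cint (fun x => (f x)%:C%C * conjc (fourier_mode k x)).

Definition modes N : set 'rV[int]_d :=
  [set k : 'rV[int]_d | forall i : 'I_d, `|k 0 i| <= N%:Z].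

(* The sum is real since f is real-valued and [modes N] is symmetric under
   k |-> -k; [complex.Re] only changes the codomain. *)
Definition fproj N f : 'rV[R]_d -> R := fun x =>
  complex.Re (\sum_(k \in modes N) (fourier_coef f k * fourier_mode k x)).

(* u belongs to H^s iff its squared norm
   \sum_k (1 + |k|^2)^s |\hat u(k)|^2 is finite. *)
Definition Hs_sqnorm (s : R) f : \bar R :=
  \esum_(k in [set: 'rV[int]_d])
    ((1 + \sum_i ((k 0 i)%:~R ^+ 2)) `^ s
      * (complex.Re (fourier_coef f k) ^+ 2
         + complex.Im (fourier_coef f k) ^+ 2))%:E.

Definition laplacian f x : R :=
  \sum_(i < d) 'D_(delta_mx 0 i) ('D_(delta_mx 0 i) f) x.

(* Classical solutions, continuous up to t = 0; the values of u at negative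
   times are irrelevant. *)
Record galerkin_allen_cahn (nu : R) N (u0 : 'rV[R]_d -> R)
    (u : R -> 'rV[R]_d -> R) : Prop := GalerkinAllenCahn {
  gac_periodic : forall t : R, 0 <= t -> torus_periodic (u t) ;
  gac_continuous : {within [set p : R * 'rV[R]_d | 0 <= p.1],
    continuous (fun p : R * 'rV[R]_d => u p.1 p.2)} ;
  gac_derivable_t : forall (t : R) x, 0 < t -> derivable (fun r => u r x) t 1 ;
  gac_derivable_x : forall (t : R) x (i : 'I_d), 0 < t ->
    derivable (u t) x (delta_mx 0 i) /\
    derivable ('D_(delta_mx 0 i) (u t)) x (delta_mx 0 i) ;
  gac_equation : forall (t : R) x, 0 < t ->
    derive1 (fun r => u r x) t =
      nu ^+ 2 * laplacian (u t) x - fproj N (fun y => u t y ^+ 3 - u t y) x ;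
  gac_initial : forall x, u 0 x = fproj N u0 x }.

End torus_functions.

(* Main.v *)
(* By Duhamel's formula and uniqueness for the heat equation, u(t) is a
   trigonometric polynomial of degree N, so f(u) = u^3 - u has degree 3N and
   f(u) - Pi_N f(u) only contains frequencies between N and 3N. Let z solve the
   heat equation with that source and zero initial datum. Heat damping on this
   band gives |z| <= K^3 polylog(N) / N^2 as long as |u| <= K: the multipliers
   are tensor products of Dirichlet-type kernels, whose L^1 norms are O(log N),
   and Abel summation handles the Gaussian weights. Now w = u - z solves
   w_t = nu^2 Laplacian w - f(w + z), and f has the sign of its argument outside
   [-1, 1], so the maximum principle bounds w, and then u, by
   max(|Pi_N u_0|, 1) + 2 sup |z|; a continuity argument in t removes the
   assumption |u| <= K. Taking K of order min(|Pi_N u_0|, log^d N) makes the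
   error at most E / N with E depending only on d and nu.
   For u_0 in H^s, Fejer means of u_0 are bounded by 1 and the tail of the
   Fourier series is estimated by Young's inequality weighted by (1 + |k|^2)^s and
   a dyadic count of lattice points, so that
   |Pi_N u_0| <= 1 + C N^(d/2 - s). *)

Require Import Defs.
From HB Require Import structures.
From mathcomp Require Import all_boot all_order all_algebra.
From mathcomp Require Import all_classical all_reals all_analysis.
From mathcomp Require Import measurable_realfun ess_sup_inf complex ring lra zify.

Import Order.TTheory GRing.Theory Num.Theory.
Import numFieldNormedType.Exports.

Local Open Scope classical_set_scope.
Local Open Scope ring_scope.

Set Implicit Arguments.
Unset Strict Implicit.
Unset Printing Implicit Defensive.

(** The obstacle is that [Pi_N] does not preserve signs: at a maximum of u nothing is known about
    the sign of Pi_N f(u). Subtracting z trades this nonlocal term for f(u), whose sign at a point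
    depends only on u there. No infinite Fourier series is needed, because the source of z has
    degree at most 3N, so z is a finite sum of damped modes. That u has degree N is not part of the
    notion of solution; it comes from uniqueness for the heat equation, which itself follows from
    the maximum principle. The factor 1 / N^2 is the time integral of exp(-c N^2 (t - s)), c = 4
    pi^2 nu^2. The logarithms to be paid for have total power 4d + 1: 3d from K^3, since |u_0| <= 1
    bounds |Pi_N u_0| by the d-th power of an L^1 bound for Dirichlet kernels, d from a tensor
    product of kernels, and one from the kernel of the frequency band. One of the two factors N
    absorbs them all, and the remaining 1 / N is below both N^(-gamma_0) and N^(-1/2). In 2 sup |z|,
    one copy is lost in passing from u to w and the other in passing back. *)

Section bounded_integrable.
Context {d} {T : measurableType d} {R : realType} (P : probability T R).

Lemma integrable_ae_bounded (F : T -> R) (M : R) : measurable_fun setT F ->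
  {ae P, forall y, `|F y| <= M} -> P.-integrable setT (EFin \o F).
Proof.
move=> mF bF; apply/integrableP; split; first exact/measurable_EFinP.
apply: (@le_lt_trans _ _ (\int[P]_x `|M|%:E)%E); last first.
  by rewrite integral_cst//= probability_setT mule1 ltry.
apply: ae_ge0_le_integral => //.
- exact/measurableT_comp/measurable_EFinP.
- apply: filterS bF => y My _ /=.
  by rewrite lee_fin (le_trans My)// ler_norm.
Qed.

Lemma integrable_bounded (F : T -> R) (M : R) : measurable_fun setT F ->
  (forall y, `|F y| <= M) -> P.-integrable setT (EFin \o F).
Proof. by move=> mF bF; apply: (@integrable_ae_bounded _ M) => //; exact: aeW. Qed.

Lemma Rintegral_setT_cst (r : R) : \int[P]_x r = r.
Proof. by rewrite Rintegral_cst//= probability_setT mulr1. Qed.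

Lemma norm_Rintegral_le_ae (F G : T -> R) :
  P.-integrable setT (EFin \o F) -> P.-integrable setT (EFin \o G) ->
  (forall y, 0 <= G y) ->
  {ae P, forall y, `|F y| <= G y} -> `|\int[P]_y F y| <= \int[P]_y G y.
Proof.
move=> iF iG G0 FG; have mF := measurable_int _ iF; have mG := measurable_int _ iG.
apply: (le_trans (le_normr_Rintegral _ _)) => //.
have iaF : P.-integrable setT (EFin \o (fun y => `|F y|)) by exact: integrable_norm.
rewrite /Rintegral fine_le//; do ?exact: integrable_fin_num.
apply: ae_ge0_le_integral => //.
- exact: measurable_int iaF.
- by move=> y _; rewrite lee_fin.
- by apply: filterS FG => y ? _; rewrite lee_fin.
Qed.

End bounded_integrable.

(** * Integrals over the unit interval and over the torus *)

Section unit_integral.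
Context (R : realType).
Local Notation U := (@unit_measure R).

Lemma unit_integral (f : R -> R) :
  U.-integrable setT (EFin \o (f : measurableTypeR R -> R)) ->
  \int[U]_x f x = \int[@lebesgue_measure R]_(x in `[0, 1[) f x.
Proof.
move=> intf; rewrite /Rintegral; congr fine.
pose N : set (measurableTypeR R) := ~` `[0, 1[%classic.
have mN : measurable N by apply: measurableC; exact: measurable_itv.
rewrite (negligible_integral mN)//; last first.
  by rewrite /= /unit_measure /mrestr /N setICl measure0.
rewrite /N setTD setCK; apply: eq_measure_integral => A mA /setIidPl A01.
by rewrite /= /unit_measure /mrestr A01.
Qed.

(** The integral from a is differentiable on both sides only strictly to the right of a, so each use
    takes a to the left of all points that matter. *)
Lemma continuous_antiderivative (f : R -> R) (a : R) : continuous f ->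
  exists F : R -> R, forall x, a < x -> is_derive x 1 F (f x).
Proof.
move=> cf; exists (fun x => \int[@lebesgue_measure R]_(t in `[a, x]) f t) => x ax.
have [] := @continuous_FTC1 R f (BLeft a) x (x + 1) _ _ _ (cf x).
- by rewrite ltrDl.
- apply: continuous_compact_integrable; first exact: segment_compact.
  exact: continuous_subspaceT.
- by rewrite lte_fin.
- by move=> dF FE; apply: DeriveDef; [exact: dF|rewrite -derive1E; exact: FE].
Qed.

Lemma unit_integral_FTC (f F : R -> R) : continuous f ->
  (forall x : R, -1 < x < 2 -> is_derive x 1 F (f x)) ->
  U.-integrable setT (EFin \o (f : measurableTypeR R -> R)) ->
  \int[U]_x f x = F 1 - F 0.
Proof.
move=> cf dF intf; rewrite unit_integral// Rintegral_itv_bndo_bndc; last first.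
  have i01 : (@lebesgue_measure R).-integrable `[0, 1] (EFin \o f).
    apply: continuous_compact_integrable; first exact: segment_compact.
    exact: continuous_subspaceT.
  by apply: integrableS i01 => //; apply: subset_itvl; rewrite bnd_simp.
rewrite /Rintegral (@continuous_FTC2 R f F 0 1)//.
- exact: continuous_subspaceT.
- have dc (x : R) : -1 < x < 2 -> {for x, continuous F}.
    move=> x1; apply: differentiable_continuous; apply/derivable1_diffP.
    by have [] := dF x x1.
  split => [x /[!in_itv]/= /andP[x0 x1]||].
  + by have [|] := dF x; [lra|].
  + by apply: cvg_at_right_filter; apply: dc; lra.
  + by apply: cvg_at_left_filter; apply: dc; lra.
- move=> x /[!in_itv]/= /andP[x0 x1]; rewrite derive1E.
  by have [|_ ->] := dF x; [lra|].
Qed.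

Lemma unit_integral_continuous (f : R -> R) : continuous f -> 
  (exists M, forall x, `|f x| <= M) ->
  U.-integrable setT (EFin \o (f : measurableTypeR R -> R)).
Proof.
move=> cf [M fM]; apply: (@integrable_bounded _ _ _ _ _ M) => //.
exact: continuous_measurable_fun.
Qed.

End unit_integral.

Section torus_fubini.
Context (R : realType).
Local Notation U := (@unit_measure R).
Local Notation mu := (@torus_measure R).
Local Notation T d := (d.-tuple (measurableTypeR R)).

(** [torus_measure] in dimension d + 1 is the image of a product measure under [tcons]; after
    transport to the product this is Fubini. It drives all inductions on the dimension. *)
Lemma torus_integralS d (F : T d.+1 -> R) (M : R) :
  measurable_fun setT F -> (forall y, `|F y| <= M) ->
  \int[mu d.+1]_y F y = \int[U]_x \int[mu d]_y F [tuple of x :: y].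
Proof.
move=> mF bF; rewrite /Rintegral; congr fine => /=.
have mFt : measurable_fun setT (F \o @tcons R d).
  by apply: measurableT_comp => //; exact: measurable_tcons.
have iF : (U \x mu d)%E.-integrable setT (EFin \o (F \o @tcons R d)).
  by apply: (@integrable_bounded _ _ _ ((U \x mu d)%E : probability _ _) _ M) => // y; exact: bF.
rewrite [LHS](@integral_distribution _ _ _ _ _ (U \x mu d)%E _ (EFin \o F))//; last exact/measurable_EFinP.
rewrite -integral12_prod_meas1//; apply: eq_integral => x _.
rewrite /fubini_F/= fineK//; apply: integrable_fin_num => //.
apply: (@integrable_bounded _ _ _ _ _ M) => //.
apply: measurableT_comp => //.
apply: (@measurable_cons _ _ _ _ (cst x) _ id); [exact: measurable_cst|exact: measurable_id].
Qed.

End torus_fubini.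

(** * Differentiation rules for functions written pointwise, and one-variable calculus *)

Section pointwise_is_derive.
Context {R : realType} {V : normedModType R}.
Implicit Types (f g : V -> R) (x v : V).

Lemma is_derive_add f g x v df dg : is_derive x v f df -> is_derive x v g dg ->
  is_derive x v (fun y => f y + g y) (df + dg).
Proof. exact: is_deriveD. Qed.

Lemma is_derive_sub f g x v df dg : is_derive x v f df -> is_derive x v g dg ->
  is_derive x v (fun y => f y - g y) (df - dg).
Proof. exact: is_deriveB. Qed.

Lemma is_derive_opp f x v df : is_derive x v f df ->
  is_derive x v (fun y => - f y) (- df).
Proof. exact: is_deriveN. Qed.

Lemma is_derive_scale f (c : R) x v df : is_derive x v f df ->
  is_derive x v (fun y => c * f y) (c * df).
Proof. exact: is_deriveZ. Qed.

Lemma is_derive_mul f g x v df dg : is_derive x v f df -> is_derive x v g dg ->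
  is_derive x v (fun y => f y * g y) (f x * dg + g x * df).
Proof. exact: is_deriveM. Qed.

Lemma is_derive_const (c : R) x v : is_derive x v (fun=> c) 0.
Proof. exact: is_derive_cst. Qed.

Lemma is_derive_sumf (I : finType) (f : I -> V -> R) x v (df : I -> R) :
  (forall i, is_derive x v (f i) (df i)) ->
  is_derive x v (fun y => \sum_i f i y) (\sum_i df i).
Proof.
move=> h; rewrite -[\sum_i df i]big_enum.
rewrite (_ : (fun _ => _) = fun y => \sum_(i <- enum I) f i y); last first.
  by apply/funext => y; rewrite big_enum.
elim: (enum I) => [|i s ih].
  rewrite big_nil (_ : (fun _ => _) = fun=> 0); first exact: is_derive_const.
  by apply/funext => y; rewrite big_nil.
rewrite big_cons (_ : (fun _ => _) = fun y => f i y + \sum_(i <- s) f i y).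
  exact: is_derive_add.
by apply/funext => y; rewrite big_cons.
Qed.

Lemma is_derive_unique f x v df dg :
  is_derive x v f df -> df = dg -> is_derive x v f dg.
Proof. by move=> ? <-. Qed.

End pointwise_is_derive.

Section one_variable.
Context {R : realType}.
Implicit Types (f g F G : R -> R).

Lemma is_derive_compose f g (x df dg : R) :
  is_derive x 1 g dg -> is_derive (g x) 1 f df ->
  is_derive x 1 (fun y => f (g y)) (dg * df).
Proof. by move=> hg hf; rewrite mulrC; exact: (@is_derive1_comp R f g x df dg). Qed.

Lemma is_derive_idf (x : R) : is_derive x 1 (fun y : R => y) 1.
Proof. exact: is_derive_id. Qed.

Lemma is_derive_affine (a b x : R) : is_derive x 1 (fun y => a + b * y) b.
Proof.
have := is_derive_add (is_derive_const a x 1) (is_derive_scale b (is_derive_idf x)).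
by rewrite add0r mulr1.
Qed.

Lemma is_derive_continuous f (x df : R) : is_derive x 1 f df -> {for x, continuous f}.
Proof.
move=> [dfx _]; apply: differentiable_continuous; exact/derivable1_diffP.
Qed.

(** Replaces monotonicity of the integral: a bound on derivatives becomes a bound on increments by
    the mean value theorem for G - F, and no time integral has to be written. *)
Lemma derive_le_increment F G f g (a b : R) : a <= b ->
  (forall x, a <= x <= b -> is_derive x 1 F (f x)) ->
  (forall x, a <= x <= b -> is_derive x 1 G (g x)) ->
  (forall x, a <= x <= b -> f x <= g x) -> F b - F a <= G b - G a.
Proof.
move=> ab dF dG fg.
have dGF x : a <= x <= b -> is_derive x 1 (fun x => G x - F x) (g x - f x).
  by move=> xab; apply: is_derive_sub; [exact: dG|exact: dF].
have [x /[!in_itv]/= xab||c /[!in_itv]/= cab e] := @MVT_segment R (fun x => G x - F x) (fun x => g x - f x) a b ab.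
- by apply: dGF; case/andP: xab => /ltW -> /ltW ->.
- apply: derivable_within_continuous => x /[!in_itv]/= xab.
  by have [] := dGF x xab.
- have : 0 <= (g c - f c) * (b - a) by rewrite mulr_ge0 ?subr_ge0// fg.
  rewrite -e; lra.
Qed.

Lemma derive_eq_increment F G f (a b : R) :
  (forall x, Num.min a b <= x <= Num.max a b -> is_derive x 1 F (f x)) ->
  (forall x, Num.min a b <= x <= Num.max a b -> is_derive x 1 G (f x)) ->
  F b - F a = G b - G a.
Proof.
wlog ab : a b / a <= b => [hw|].
  have [ab|ba] := orP (le_total a b); first exact: hw.
  rewrite minC maxC => hF hG; have := hw b a ba hF hG; lra.
rewrite (min_idPl ab) (max_idPr ab) => hF hG.
by apply/eqP; rewrite eq_le !(@derive_le_increment _ _ f f).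
Qed.

(** Halving the angle, sin y = 2 cos (y / 2) sin (y / 2). On [0, pi / 4] the cosine is at least cos
    (pi / 4), hence sin (y / 2) >= cos (pi / 4) y / 2, and cos (pi / 4)^2 = 1 / 2. *)
Lemma sin_lower (y : R) : 0 <= y <= pi / 2 -> y / 2 <= sin y.
Proof.
move=> /andP[y0 yp].
have pi2 := pi_ge2 R.
have h (v : R) : 0 <= v <= pi / 4 -> cos (pi / 4) <= cos v.
  move=> /andP[v0 v4]; rewrite leNgt ltr_cos ?in_itv/= -?leNgt//; lra.
have c4 : cos (pi / 4) ^+ 2 *+ 2 = 1 :> R.
  have := cos_mulr2n (pi / 4 : R).
  have -> : pi / 4 *+ 2 = pi / 2 :> R by rewrite -mulr_natr; field.
  by rewrite cos_pihalf => /eqP; rewrite eq_sym subr_eq0 => /eqP.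
have c0 : 0 <= cos (pi / 4) :> R by apply: cos_ge0_pihalf; lra.
have s4 : cos (pi / 4) * (y / 2) <= sin (y / 2).
  have := @derive_le_increment (fun x => cos (pi / 4) * x) sin (fun x => cos (pi / 4)) cos 0 (y / 2).
  rewrite mulr0 sin0 !subr0; apply; first lra.
  - move=> x _; have := is_derive_scale (cos (pi / 4)) (is_derive_idf x).
    by rewrite mulr1.
  - by move=> x /andP[x0 xy]; apply: h; lra.
have -> : sin y = cos (y / 2) * sin (y / 2) * 2.
  by rewrite mulr_natr -sin_mulr2n; congr sin; rewrite -mulr_natr; field.
have cy : cos (pi / 4) <= cos (y / 2) by apply: h; lra.
have : cos (pi / 4) * (cos (pi / 4) * (y / 2)) <= cos (y / 2) * sin (y / 2).
  by apply: ler_pM => //; rewrite mulr_ge0//; lra.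
rewrite mulrA -expr2; move: c4; rewrite -mulr_natr; nra.
Qed.

End one_variable.

(** * One-dimensional kernels: Dirichlet, Fejer, and monotone weights *)

Section trig_kernels.
Context {R : realType}.
Implicit Types (w : nat -> R) (n m : nat) (x a : R).

(** The sum of w(|k|) e^{2 pi i k x} over |k| <= n, with k and -k paired to stay real. Weight 1
    gives the Dirichlet kernel [dir]. *)
Definition ker w n x : R :=
  w 0%N + 2 * \sum_(i < n) w i.+1 * cos (2 * pi * (i.+1%:R * x)).

Definition dir n : R -> R := ker (fun=> 1) n.

Lemma ker0 w x : ker w 0 x = w 0%N.
Proof. by rewrite /ker big_ord0 mulr0 addr0. Qed.

Lemma kerS w n x :
  ker w n.+1 x = ker w n x + 2 * (w n.+1 * cos (2 * pi * (n.+1%:R * x))).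
Proof. by rewrite /ker big_ord_recr/= mulrDr addrA. Qed.

(** Summation by parts. For nonincreasing nonnegative weights all coefficients are nonnegative and
    add up to w 0, so L^1 bounds for Dirichlet kernels pass to [ker w n] at the sole cost of the
    factor w 0. *)
Lemma ker_abel w n x : ker w n x =
  \sum_(j < n) (w j - w j.+1) * dir j x + w n * dir n x.
Proof.
elim: n => [|n ih]; first by rewrite big_ord0 add0r /dir !ker0 mulr1.
rewrite kerS ih big_ord_recr/= /dir kerS; ring.
Qed.

Lemma cos_period (b : R) (k : nat) : cos (b + 2 * pi * k%:R) = cos b.
Proof.
rewrite (_ : 2 * pi * k%:R = (pi *+ 2) *+ k); first exact: (periodicn (@cosD2pi R)).
by rewrite -[RHS]mulr_natr -[pi *+ 2]mulr_natl.
Qed.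

Lemma ker_periodic w n x : ker w n (x + 1) = ker w n x.
Proof.
rewrite /ker; congr (_ + _ * _); apply: eq_bigr => i _; congr (_ * _).
by rewrite [_ * (x + 1)]mulrDr mulr1 [2 * pi * (_ + _)]mulrDr cos_period.
Qed.

(** The closed form of the Dirichlet kernel without division, hence valid at integers too. *)
Lemma dir_sin n x : sin (pi * x) * dir n x = sin ((2 * n%:R + 1) * (pi * x)).
Proof.
elim: n => [|n ih]; first by rewrite /dir ker0 mulr1 mulr0 add0r mul1r.
rewrite /dir kerS mulrDr ih mul1r.
have -> : (2 * n%:R + 1) * (pi * x) = 2 * pi * (n.+1%:R * x) - pi * x by rewrite -natr1; ring.
have -> : (2 * n.+1%:R + 1) * (pi * x) = 2 * pi * (n.+1%:R * x) + pi * x by ring.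
rewrite sinB sinD; ring.
Qed.

Lemma ker_bound w n x : `|ker w n x| <= `|w 0%N| + 2 * \sum_(i < n) `|w i.+1|.
Proof.
rewrite (le_trans (ler_normD _ _))// lerD2l normrM ger0_norm// ler_pM2l//.
rewrite (le_trans (ler_norm_sum _ _ _))// ler_sum// => i _.
by rewrite normrM ler_piMr// cos_max.
Qed.

Lemma dir_bound n x : `|dir n x| <= 2 * n%:R + 1.
Proof.
rewrite (le_trans (ker_bound _ _ _))// normr1 sumr_const card_ord.
by rewrite addrC.
Qed.

Lemma is_derive_cos_affine (c e : R) x :
  is_derive x 1 (fun y => cos (c + e * y)) (- (e * sin (c + e * x))).
Proof.
have := is_derive_compose (is_derive_affine c e x) (is_derive_cos (c + e * x)).
by rewrite mulrN.
Qed.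

Lemma is_derive_sin_affine (c e : R) x :
  is_derive x 1 (fun y => sin (c + e * y)) (e * cos (c + e * x)).
Proof.
exact: is_derive_compose (is_derive_affine c e x) (is_derive_sin (c + e * x)).
Qed.

Lemma ker_continuous w n : continuous (ker w n).
Proof.
move=> x; apply: (@is_derive_continuous _ _ _ (0 + 2 * \sum_(i < n) w i.+1 * (- (2 * pi * i.+1%:R * sin (0 + 2 * pi * i.+1%:R * x))))).
have hi (i : 'I_n) : is_derive x 1 (fun x => w i.+1 * cos (2 * pi * (i.+1%:R * x)))
    (w i.+1 * (- (2 * pi * i.+1%:R * sin (0 + 2 * pi * i.+1%:R * x)))).
  apply: is_derive_scale.
  have := is_derive_cos_affine 0 (2 * pi * i.+1%:R) x.
  by under eq_fun do rewrite add0r -mulrA.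
exact: (is_derive_add (is_derive_const (w 0%N) x 1) (is_derive_scale 2 (is_derive_sumf hi))).
Qed.

End trig_kernels.

(** * L^1 bounds for the kernels *)

Section l1_bounds.
Context {R : realType}.
Local Notation U := (@unit_measure R).
Implicit Types (h g : R -> R).

(* The integral runs over all translates so that no change of variables on the
   circle is needed when the kernel is convolved. *)
Record l1le h (B : R) : Prop := L1le {
  l1le_cont : continuous h ;
  l1le_bdd : exists M : R, forall x, `|h x| <= M ;
  l1le_int : forall a, \int[U]_y `|h (a - y)| <= B }.

Lemma continuous_reflect (h : R -> R) (a : R) : continuous h ->
  continuous (fun y => h (a - y)).
Proof.
move=> ch y; apply: (@continuous_comp _ _ _ (fun y => a - y) h); last exact: ch.
apply: (@is_derive_continuous _ _ _ (0 - 1)).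
Qed.

Lemma continuous_normr (h : R -> R) : continuous h -> continuous (fun y => `|h y|).
Proof. by move=> ch y; apply: cvg_norm; exact: ch. Qed.

Lemma integrable_reflect h (a : R) : continuous h -> (exists M : R, forall x, `|h x| <= M) ->
  U.-integrable setT (EFin \o ((fun y => h (a - y)) : measurableTypeR R -> R)).
Proof.
move=> ch [M hM]; apply: unit_integral_continuous; first exact: continuous_reflect.
by exists M => x.
Qed.

Lemma integrable_norm_reflect h (a : R) : continuous h -> (exists M : R, forall x, `|h x| <= M) ->
  U.-integrable setT (EFin \o ((fun y => `|h (a - y)|) : measurableTypeR R -> R)).
Proof.
move=> ch [M hM]; apply: (@integrable_reflect (fun y => `|h y|)).
  exact: continuous_normr.
by exists M => x; rewrite normr_id.
Qed.

Lemma l1le_ext h g B : h =1 g -> l1le h B -> l1le g B.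
Proof. by move=> /funext ->. Qed.

Lemma l1le_weaken h B C : B <= C -> l1le h B -> l1le h C.
Proof. by move=> BC [ch bh ih]; split => // a; exact: le_trans (ih a) BC. Qed.

Lemma l1le_ge0 h B : l1le h B -> 0 <= B.
Proof. by move=> [_ _ /(_ 0)]; apply: le_trans; apply: Rintegral_ge0. Qed.

Lemma l1le_add h g B C : l1le h B -> l1le g C -> l1le (fun x => h x + g x) (B + C).
Proof.
move=> [ch bh ih] [cg bg ig]; split.
- by move=> x; apply: cvgD; [exact: ch|exact: cg].
- case: bh bg => M hM [M' gM]; exists (M + M') => x.
  by rewrite (le_trans (ler_normD _ _))// lerD.
- move=> a; apply: (@le_trans _ _ (\int[U]_y (`|h (a - y)| + `|g (a - y)|))); last first.
    by rewrite RintegralD//; [exact: lerD|exact: integrable_norm_reflect..].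
  apply: le_Rintegral => //.
  + apply: (@integrable_norm_reflect (fun x => h x + g x)).
      by move=> x; apply: cvgD; [exact: ch|exact: cg].
    case: bh bg => M hM [M' gM]; exists (M + M') => x.
    by rewrite (le_trans (ler_normD _ _))// lerD.
  + apply: (@integrableD _ _ _ U setT _ (fun y => `|h (a - y)|%:E) (fun y => `|g (a - y)|%:E)) => //; exact: integrable_norm_reflect.
  + by move=> y _; exact: ler_normD.
Qed.

Lemma l1le_scale h B (c : R) : l1le h B -> l1le (fun x => c * h x) (`|c| * B).
Proof.
move=> [ch bh ih]; split.
- by move=> x; apply: cvgM; [exact: cvg_cst|exact: ch].
- case: bh => M hM; exists (`|c| * M) => x; by rewrite normrM ler_wpM2l.
- move=> a; under eq_Rintegral do rewrite normrM.
  by rewrite RintegralZl//; [exact: ler_wpM2l|exact: integrable_norm_reflect].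
Qed.

Lemma l1le_sum n (h : 'I_n -> R -> R) (B : 'I_n -> R) :
  (forall i, l1le (h i) (B i)) -> l1le (fun x => \sum_i h i x) (\sum_i B i).
Proof.
elim: n h B => [|n ih] h B hB.
  apply: (@l1le_ext (fun=> 0)) => [x|]; first by rewrite big_ord0.
  rewrite big_ord0; split.
  - by move=> x; exact: cvg_cst.
  - by exists 0 => x; rewrite normr0.
  - by move=> a; rewrite normr0 Rintegral_setT_cst.
rewrite big_ord_recl; apply: (@l1le_ext (fun x => h ord0 x + \sum_(i < n) h (lift ord0 i) x)) => [x|].
  by rewrite big_ord_recl.
by apply: l1le_add => //; exact: ih.
Qed.

(** The integral over a translated period equals the one over [-1/2, 1/2], where bounds in terms of
    |x| apply. It is given through an antiderivative, in the form that [derive_le_increment] can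
    use. *)
Lemma unit_integral_periodic h (a : R) : continuous h ->
  (exists M : R, forall x, `|h x| <= M) -> (forall x, h (x + 1) = h x) ->
  exists2 F : R -> R, (forall x : R, -1 <= x <= 1 -> is_derive x 1 F (h x)) &
    \int[U]_y h (a - y) = F (2^-1) - F (- 2^-1).
Proof.
move=> ch bh ph.
(* The base point lies to the left of all points at which F is differentiated: a - y with y < 2, and
   x - 1 with x > -|a| - 2. *)
have [F dF] := continuous_antiderivative (- `|a| - 3) ch.
have a1 := ler_norm (- a); have a2 := ler_norm a; rewrite normrN in a1.
exists F; first by move=> x /andP[x1 _]; apply: dF; lra.
have dFr (y : R) : -1 < y < 2 -> is_derive y 1 (fun y => - F (a - y)) (h (a - y)).
  move=> /andP[y1 y2].
  have -> : h (a - y) = - (- 1 * h (a + - 1 * y)) by rewrite mulN1r opprK mulN1r.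
  rewrite (_ : (fun y => - F (a - y)) = fun y => - F (a + - 1 * y)); last first.
    by apply/funext => z; rewrite mulN1r.
  apply: is_derive_opp; apply: is_derive_compose; first exact: is_derive_affine.
  by apply: dF; lra.
rewrite (unit_integral_FTC (@continuous_reflect h a ch) dFr (integrable_reflect a ch bh)).
(* By periodicity F(x) - F(x - 1) is constant; it is compared at x = a and x = 1/2. *)
have dFF x : - `|a| - 2 < x -> is_derive x 1 (fun x => F x - F (x - 1)) 0.
    move=> ax; rewrite -(subrr (h x)); apply: is_derive_sub; first by apply: dF; lra.
    have -> : h x = 1 * h (- 1 + 1 * x).
      by rewrite !mul1r -[h (-1 + x)]ph; congr h; ring.
    apply: (is_derive_unique (df := 1 * h (- 1 + 1 * x))) => //.
    rewrite (_ : (fun y => F (y - 1)) = fun y => F (-1 + 1 * y)); last first.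
      by apply/funext => y; congr F; ring.
    apply: is_derive_compose; first exact: is_derive_affine.
    by apply: dF; lra.
  have := @derive_eq_increment _ (fun x => F x - F (x - 1)) (fun=> 0) (fun=> 0) a 2^-1.
  rewrite subrr => e; rewrite subr0.
  have -> : - 2^-1 = 2^-1 - 1 :> R by lra.
  have {}e : F (2^-1) - F (2^-1 - 1) - (F a - F (a - 1)) = 0.
    apply: e => x xa.
    apply: dFF; case/andP: xa => + _; rewrite ge_min => /orP[]; lra.
  by lra.
Qed.

(** With M = 2n + 1, this merges |D_n| <= M, used when M |x| <= 1, with |D_n| <= 1 / |x|, which
    follows from [dir_sin] and |sin (pi x)| >= |x|. The merged bound has a logarithm as explicit
    antiderivative. *)
Lemma dir_pointwise n (x : R) : - 2^-1 <= x <= 2^-1 ->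
  `|dir n x| <= 2 * (2 * n%:R + 1) / (1 + (2 * n%:R + 1) * `|x|).
Proof.
move=> x12; set M : R := 2 * n%:R + 1.
have M0 : 0 < M by rewrite ltr_wpDl// mulr_ge0.
have D0 : 0 < 1 + M * `|x| by rewrite ltr_wpDr// mulr_ge0// ltW.
rewrite ler_pdivlMr//.
have [Mx|Mx] := leP (M * `|x|) 1.
  rewrite mulrC; apply: ler_pM => //; [exact: ltW|lra|exact: dir_bound].
have pi2 := pi_ge2 R.
have x0 : 0 < `|x| by rewrite -(pmulr_rgt0 _ M0); lra.
have sx : `|x| <= `|sin (pi * x)|.
  have -> : `|sin (pi * x)| = `|sin (pi * `|x|)|.
    by have [x0'|x0'] := ger0P x; rewrite ?mulrN ?sinN ?normrN.
  have xle : `|x| <= 2^-1 by rewrite ler_norml.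
  have : pi * `|x| / 2 <= sin (pi * `|x|).
    by apply: sin_lower; rewrite mulr_ge0 ?pi_ge0//= ler_pM2l ?pi_gt0.
  move=> h; apply: le_trans (ler_norm _); apply: le_trans h.
  have : 2 * `|x| <= pi * `|x| by rewrite ler_wpM2r.
  by lra.
have h1 : `|dir n x| * `|x| <= 1.
  apply: (@le_trans _ _ (`|sin (pi * x)| * `|dir n x|)).
    by rewrite mulrC ler_wpM2r.
  by rewrite -normrM dir_sin sin_max.
have : `|dir n x| * (M * `|x|) <= M.
  by rewrite mulrCA ler_piMr// ltW.
have : `|dir n x| <= `|dir n x| * (M * `|x|) by rewrite ler_peMr// ltW.
rewrite mulrDr mulr1; lra.
Qed.

(** Each half of [-1/2, 1/2] contributes at most 2 ln (1 + M / 2) by integrating [dir_pointwise]; 1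
    + M / 2 is then rounded up to 1 + M = 2 + 2n. *)
Lemma dir_l1 n : l1le (dir n) (4 * ln (2 + 2 * n%:R)).
Proof.
have bd : exists M : R, forall x : R, `|dir n x| <= M.
  by exists (2 * n%:R + 1) => x; exact: dir_bound.
split => //; first exact: ker_continuous.
move=> a.
have [|||F dF ->] := @unit_integral_periodic (fun x => `|dir n x|) a.
- by apply: continuous_normr; exact: ker_continuous.
- by case: bd => M hM; exists M => x; rewrite normr_id.
- by move=> x; rewrite /dir ker_periodic.
set M : R := 2 * n%:R + 1.
have M0 : 0 < M by rewrite ltr_wpDl// mulr_ge0.
have MN : 2 + 2 * n%:R = 1 + M :> R by rewrite /M; ring.
have lnM : ln (1 + M * 2^-1) <= ln (1 + M) by rewrite ler_ln ?posrE; lra.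
have h1 : F 2^-1 - F 0 <= 2 * ln (1 + M * 2^-1) - 2 * ln (1 + M * 0).
  apply: (@derive_le_increment _ F (fun x => 2 * ln (1 + M * x)) (fun x => `|dir n x|) (fun x => 2 * (M * (1 + M * x)^-1))).
  - by lra.
  - by move=> x x01; apply: dF; lra.
  - move=> x /andP[x0 _]; apply: is_derive_scale; apply: is_derive_compose.
      exact: is_derive_affine.
    by apply: is_derive1_ln; rewrite ltr_wpDr// mulr_ge0// ltW.
  - move=> x /andP[x0 x1]; rewrite mulrA.
    have := @dir_pointwise n x; rewrite (ger0_norm x0); apply; lra.
have h2 : F 0 - F (- 2^-1) <= - 2 * ln (1 + - M * 0) - (- 2 * ln (1 + - M * - 2^-1)).
  apply: (@derive_le_increment _ F (fun x => - 2 * ln (1 + - M * x)) (fun x => `|dir n x|) (fun x => - 2 * (- M * (1 + - M * x)^-1))).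
  - by lra.
  - by move=> x x01; apply: dF; lra.
  - move=> x /andP[_ x0]; apply: is_derive_scale; apply: is_derive_compose.
      exact: is_derive_affine.
    by apply: is_derive1_ln; rewrite ltr_wpDr// mulNr -mulrN mulr_ge0// ?oppr_ge0// ltW.
  - move=> x /andP[x1 x0]; rewrite mulrA mulrNN.
    have := @dir_pointwise n x; rewrite (ler0_norm x0) mulrN mulNr; apply; lra.
rewrite mulr0 addr0 ln1 mulr0 ?subr0 in h1.
rewrite mulr0 addr0 ln1 mulr0 mulrNN ?sub0r in h2.
rewrite MN; lra.
Qed.

Lemma ker_l1 w n B : (forall j, (j <= n)%N -> l1le (dir j) B) ->
  (forall j, w j.+1 <= w j) -> (forall j, 0 <= w j) -> l1le (ker w n) (w 0%N * B).
Proof.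
move=> hB wd w0; apply: (@l1le_ext (fun x => \sum_(j < n) (w j - w j.+1) * dir j x + w n * dir n x)).
  by move=> x; rewrite ker_abel.
have -> : w 0%N * B = \sum_(j < n) `|w j - w j.+1| * B + `|w n| * B.
  rewrite -mulr_suml -mulrDl; congr (_ * _).
  rewrite (eq_bigr (fun j : 'I_n => w j - w j.+1)); last first.
    by move=> j _; rewrite ger0_norm// subr_ge0.
  rewrite ger0_norm//.
  elim: (n) => [|m ih]; first by rewrite big_ord0 add0r.
  rewrite big_ord_recr/= {1}ih; ring.
apply: l1le_add; last by apply: l1le_scale; exact: hB.
apply: l1le_sum => j; apply: l1le_scale; apply: hB; exact: ltnW.
Qed.

(** Gains w (n + 1) over the bound w 0 that the two kernels have separately. Freezing the weights
    below n + 1 at the value w (n + 1) gives a monotone sequence v, and the band is [ker v m] minus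
    w (n + 1) times the Dirichlet kernel of degree n. *)
Lemma ker_band_l1 w n m B : (n <= m)%N -> (forall j, (j <= m)%N -> l1le (dir j) B) ->
  (forall j, w j.+1 <= w j) -> (forall j, 0 <= w j) ->
  l1le (fun x => ker w m x - ker w n x) (2 * w n.+1 * B).
Proof.
move=> nm hB wd w0; pose v i := w (maxn i n.+1).
have keq x : ker w m x - ker w n x = ker v m x + (- w n.+1) * dir n x.
  have -> : w n.+1 = v 0%N by rewrite /v max0n.
  have h k : (k <= n)%N -> ker v k x = v 0%N * dir k x.
    elim: k => [_|k ih kn]; first by rewrite /dir !ker0 mulr1.
    rewrite kerS ih 1?ltnW// /dir kerS /v max0n (maxn_idPr _) ?leqW//; ring.
  rewrite mulNr -h//.
  move: nm; elim: (m) => [|k ih]; first by rewrite leqn0 => /eqP ->; rewrite !subrr.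
  rewrite leq_eqVlt => /predU1P[->|]; first by rewrite !subrr.
  rewrite ltnS => nk; rewrite !kerS /v (maxn_idPl _) ?ltnS//.
  have := ih nk; lra.
apply: (l1le_ext (fun x => esym (keq x))).
have -> : 2 * w n.+1 * B = v 0%N * B + `|- w n.+1| * B.
  by rewrite /v max0n normrN ger0_norm//; ring.
apply: l1le_add; last by apply: l1le_scale; exact: hB.
apply: ker_l1 => //.
- move=> j; rewrite /v; have [jn|nj] := leqP j n.
    by rewrite (maxn_idPr (leqW jn)) (maxn_idPr _).
  by rewrite (maxn_idPl nj) (maxn_idPl (leqW nj)).
- by move=> j; exact: w0.
Qed.

Definition fejer n (i : nat) : R := 1 - i%:R / n.+1%:R.

(** Up to the factor 1 / (n + 1) this is the sum of the Dirichlet kernels of degree at most n, which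
    equals the squared modulus of the sum of e^{ijt}, 0 <= j <= n, with t = 2 pi x. *)
Lemma ker_fejer_ge0 n x : 0 <= ker (fejer n) n x.
Proof.
have n0 : n.+1%:R != 0 :> R by rewrite pnatr_eq0.
have -> : ker (fejer n) n x = n.+1%:R^-1 * \sum_(j < n.+1) dir j x.
  rewrite ker_abel big_ord_recr/= [RHS]mulrDr mulr_sumr; congr (_ + _).
    by apply: eq_bigr => j _; congr (_ * _); rewrite /fejer -natr1; field.
  by congr (_ * _); rewrite /fejer -natr1; field; rewrite natr1.
rewrite mulr_ge0//.
pose t := 2 * pi * x : R.
pose C m := \sum_(j < m.+1) cos (j%:R * t); pose S m := \sum_(j < m.+1) sin (j%:R * t).
suff -> : \sum_(j < n.+1) dir j x = C n ^+ 2 + S n ^+ 2 by rewrite addr_ge0 ?sqr_ge0.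
(* Half of the cross term in the increment of C^2 + S^2; together with cos^2 + sin^2 = 1 the
   increment is the next Dirichlet kernel. *)
have dirE m : cos (m.+1%:R * t) * C m + sin (m.+1%:R * t) * S m = \sum_(j < m.+1) cos (j.+1%:R * t).
  rewrite /C /S !mulr_sumr -big_split/= (reindex_inj rev_ord_inj)/=.
  apply: eq_bigr => j _; rewrite -cosB; congr cos.
  rewrite -mulrBl -natrB; last by rewrite subSS leqW// leq_subr.
  by congr (_%:R * _); rewrite subSS subSn ?leq_subr// subKn// -ltnS.
elim: n {n0} => [|n ih].
  by rewrite /C /S !big_ord1 /dir ker0 !mul0r cos0 sin0 expr1n expr0n/= addr0.
rewrite big_ord_recr/= ih /dir /ker.
have -> : \sum_(i < n.+1) 1 * cos (2 * pi * (i.+1%:R * x)) = \sum_(j < n.+1) cos (j.+1%:R * t).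
  by apply: eq_bigr => j _; rewrite mul1r /t; congr cos; ring.
rewrite -dirE.
have -> : C n.+1 = C n + cos (n.+1%:R * t) by rewrite /C big_ord_recr.
have -> : S n.+1 = S n + sin (n.+1%:R * t) by rewrite /S big_ord_recr.
have := cos2Dsin2 (n.+1%:R * t); nra.
Qed.

Lemma cos_period_int (b : R) (z : int) : cos (b + 2 * pi * z%:~R) = cos b.
Proof.
case: z => n; first exact: cos_period.
rewrite NegzE mulrNz mulrN -[in RHS](subrK (2 * pi * n.+1%:R) b).
by rewrite cos_period.
Qed.

Lemma unit_integral_cos (t : R) (z : int) :
  \int[U]_y cos (t + 2 * pi * (z%:~R * y)) = (z == 0)%:R * cos t.
Proof.
have [->|z0] := eqVneq z 0.
  under eq_Rintegral do rewrite mul0r mulr0 addr0.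
  by rewrite Rintegral_setT_cst mul1r.
pose c : R := 2 * pi * z%:~R.
have c0 : c != 0 by rewrite !mulf_neq0 ?intr_eq0// gt_eqF// pi_gt0.
under eq_Rintegral do rewrite mulrA -/c.
have cc : continuous (fun y => cos (t + c * y)).
  move=> y; exact: is_derive_continuous (is_derive_cos_affine _ _ _).
have dF (y : R) : -1 < y < 2 -> is_derive y 1
    (fun y => c^-1 * sin (t + c * y)) (cos (t + c * y)).
  move=> _; apply: is_derive_unique (is_derive_scale _ (is_derive_sin_affine _ _ _)) _.
  by rewrite mulrA mulVf// mul1r.
rewrite (unit_integral_FTC cc dF); last first.
  by apply: unit_integral_continuous => //; exists 1 => y; exact: cos_max.
rewrite mulr0 addr0 mulr1 mul0r -!(cosBpihalf (t + _)) /c addrAC cos_period_int.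
by rewrite cosBpihalf subrr.
Qed.

Lemma integral_ker w n a : \int[U]_y ker w n (a - y) = w 0%N.
Proof.
elim: n => [|n ih].
  by under eq_Rintegral do rewrite ker0; rewrite Rintegral_setT_cst.
under eq_Rintegral do rewrite kerS mulrA.
have ci : continuous (fun y : R => cos (2 * pi * (n.+1%:R * y))).
  (* The single cosine is itself a kernel, with weight 1/2 at index n + 1 and 0 elsewhere. *)
  have := @ker_continuous R (fun i => (i == n.+1)%:R / 2) n.+1.
  rewrite (_ : ker _ _ = fun y : R => cos (2 * pi * (n.+1%:R * y)))//.
  apply/funext => y; rewrite kerS eqxx /ker/= mul0r big1 => [|i _]; first by field.
  by rewrite eqSS ltn_eqF ?mul0r.
have bi : exists M : R, forall y, `|cos (2 * pi * (n.+1%:R * y))| <= M.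
  by exists 1 => y; exact: cos_max.
have kb : exists M : R, forall y, `|ker w n y| <= M.
  by eexists => y; exact: ker_bound.
have ii := integrable_reflect a ci bi.
rewrite RintegralD//.
- rewrite ih RintegralZl//.
  under [X in _ + _ * X]eq_Rintegral => y _.
    have -> : 2 * pi * (n.+1%:R * (a - y)) =
        2 * pi * (n.+1%:R * a) + 2 * pi * ((- n.+1%:Z)%:~R * y) by rewrite mulrNz; ring.
    over.
  by rewrite unit_integral_cos oppr_eq0 mul0r mulr0 addr0.
- exact: (@integrable_reflect (ker w n) a (@ker_continuous R w n) kb).
- exact: (@integrableZl _ _ _ U setT measurableT (2 * w n.+1) _ ii).
Qed.

(** By positivity the L^1 norm is the mean, which is the weight at 0. The constant is exactly 1, so
    Fejer means do not increase a sup bound. *)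
Lemma fejer_l1 n : l1le (ker (fejer n) n) 1.
Proof.
split; first exact: ker_continuous.
- by eexists => y; exact: ker_bound.
- move=> a; under eq_Rintegral do rewrite ger0_norm ?ker_fejer_ge0//.
  by rewrite integral_ker /fejer mul0r subr0.
Qed.

End l1_bounds.

(** * Cubes of frequencies and tensor product kernels *)

Section mode_boxes.
Context {d : nat}.

(** A finite type for the cube of modes, each coordinate being shifted by n. Sums over the set
    [modes n] thus become ordinary big sums, to which distributivity applies. *)
Definition mode_box (n : nat) := {ffun 'I_d -> 'I_(2 * n).+1}.

Definition box_mode n (phi : mode_box n) : 'rV[int]_d :=
  \row_j ((phi j)%:Z - n%:Z).

Lemma box_mode_inj n : injective (@box_mode n).
Proof.
move=> phi psi /rowP e; apply/ffunP => j; apply/val_inj.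
by have := e j; rewrite !mxE => /addIr [].
Qed.

Lemma modesE n (k : 'rV[int]_d) : modes n k <-> exists phi : mode_box n, box_mode phi = k.
Proof.
split=> [kn|[phi <-] i]; last first.
  by rewrite mxE; have := ltn_ord (phi i); lia.
have kj (j : 'I_d) : (absz (k 0%R j + n%:Z)%R < (2 * n).+1)%N by have := kn j; lia.
exists [ffun j => Ordinal (kj j)]; apply/rowP => j; rewrite !mxE ffunE/=.
by have := kn j; lia.
Qed.

Lemma sum_modes (V : nmodType) n (F : 'rV[int]_d -> V) :
  \sum_(k \in modes n) F k = \sum_(phi : mode_box n) F (box_mode phi).
Proof.
rewrite (@fsbigE _ _ _ _ _ [seq box_mode phi | phi <- enum {: mode_box n}]).
- rewrite big_map big_enum_cond/=; apply: eq_bigl => phi.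
  by rewrite mem_set//; apply/modesE; exists phi.
- by rewrite map_inj_uniq ?enum_uniq//; exact: box_mode_inj.
- by move=> k /= /mapP[phi _ ->]; apply/modesE; exists phi.
- move=> k /modesE[phi <-]; apply: contraNeq => _.
  by apply: map_f; rewrite mem_enum.
Qed.

End mode_boxes.

Lemma sum_symmetric (V : nmodType) n (g : int -> V) :
  \sum_(i < (2 * n).+1) g (i%:Z - n%:Z) =
  g 0 + \sum_(i < n) (g i.+1%:Z + g (- i.+1%:Z)).
Proof.
elim: n => [|n ih]; first by rewrite !big_ord0 addr0 big_ord_recl [X in _ + X]big1 ?addr0// => -[].
rewrite mulnS !addSn add0n big_ord_recl big_ord_recr/= [X in _ = _ + X]big_ord_recr/=.
have -> : \sum_(i < (2 * n).+1) g ((bump 0 i)%:Z - n.+1%:Z) = \sum_(i < (2 * n).+1) g (i%:Z - n%:Z).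
  by apply: eq_bigr => i _; congr g; rewrite /bump/=; lia.
rewrite ih addrC -!addrA; congr (_ + (_ + (_ + _))); congr g; rewrite /bump/=; lia.
Qed.

Section cis.
Context {R : realType}.
Local Open Scope complex_scope.

Definition cis (t : R) : R[i] := Complex (cos t) (sin t).

Lemma cisD a b : cis (a + b) = cis a * cis b.
Proof. by apply/eqP; rewrite eq_complex/= cosD sinD eqxx/= addrC. Qed.

Lemma cis0 : cis 0 = 1.
Proof. by rewrite /cis cos0 sin0. Qed.

Lemma cis_sum (I : finType) (t : I -> R) : cis (\sum_i t i) = \prod_i cis (t i).
Proof. by apply: big_morph => //; [exact: cisD|exact: cis0]. Qed.

Lemma cisM_real (w t : R) : w%:C * cis t = Complex (w * cos t) (w * sin t).
Proof. by rewrite /cis; simpc. Qed.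

Lemma Re_sum (I : finType) (F : I -> R[i]) :
  complex.Re (\sum_i F i) = \sum_i complex.Re (F i).
Proof. exact: (raddf_sum (@complex.Re R : {additive R[i] -> R})).
Qed.

Lemma kerE_cis (w : nat -> R) n x : (ker w n x)%:C =
  \sum_(i < (2 * n).+1) (w (absz (i%:Z - n%:Z)))%:C * cis (2 * pi * ((i%:Z - n%:Z)%:~R * x)).
Proof.
rewrite (sum_symmetric n (fun z => (w (absz z))%:C * cis (2 * pi * (z%:~R * x)))).
rewrite mul0r mulr0 cis0 mulr1 /ker rmorphD/=; congr (_ + _).
rewrite rmorphM rmorph_sum mulr_sumr; apply: eq_bigr => i _.
rewrite mulrNz !mulNr !mulrN !cisM_real cosN sinN.
apply/eqP; rewrite eq_complex/=; apply/andP; split; apply/eqP; ring.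
Qed.

End cis.

Section product_kernels.
Context {R : realType} {d : nat}.
Implicit Types (k : 'rV[int]_d) (x : 'rV[R]_d).
Local Open Scope complex_scope.

Definition mode_cos k x : R := cos (2 * pi * dotZ k x).
Definition mode_sin k x : R := sin (2 * pi * dotZ k x).

Definition mode_weight (w : nat -> R) k : R := \prod_j w (absz (k 0%R j)).

(** In exponential form, expanding the product by distributivity yields one term per mode, and [cis]
    turns the product of exponentials into the exponential of k.x. The product is real, so taking
    real parts at the end loses nothing. *)
Lemma prod_ker (w : nat -> R) n x : \prod_j ker w n (x 0 j) =
  \sum_(k \in modes n) mode_weight w k * mode_cos k x.
Proof.
transitivity (complex.Re (\prod_j ker w n (x 0 j))%:C) => //.
rewrite sum_modes rmorph_prod/=; under eq_bigr do rewrite kerE_cis.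
rewrite (bigA_distr_bigA (fun (j : 'I_d) (i : 'I_(2 * n).+1) =>
  (w (absz (i%:Z - n%:Z)))%:C * cis (2 * pi * ((i%:Z - n%:Z)%:~R * x 0 j))))/=.
rewrite Re_sum; apply: eq_bigr => phi _.
rewrite big_split/= -cis_sum -mulr_sumr -rmorph_prod cisM_real/=.
by congr (_ * cos (_ * _)); apply: eq_bigr => j _; rewrite mxE.
Qed.

End product_kernels.

(** * Integrals of products and orthogonality on the torus *)

Section product_integrals.
Context {R : realType}.
Local Notation U := (@unit_measure R).
Local Notation mu := (@torus_measure R).
Local Notation T d := (d.-tuple (measurableTypeR R)).

Lemma measurable_prod_tnth d (h : 'I_d -> R -> R) : (forall i, continuous (h i)) ->
  measurable_fun setT (fun y : T d => \prod_i h i (tnth y i)).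
Proof.
move=> ch; apply: measurable_prod => i _.
by apply: (measurableT_comp (continuous_measurable_fun (ch i))); exact: measurable_tnth.
Qed.

Lemma prod_norm_le d (a M : 'I_d -> R) : (forall i, `|a i| <= M i) ->
  `|\prod_i a i| <= \prod_i M i.
Proof. by move=> aM; rewrite normr_prod; apply: ler_prod => i _; rewrite normr_ge0 aM. Qed.

Lemma torus_integral_prod d (h : 'I_d -> R -> R) : (forall i, continuous (h i)) ->
  (forall i, exists M : R, forall x, `|h i x| <= M) ->
  \int[mu d]_y \prod_i h i (tnth y i) = \prod_i \int[U]_x h i x.
Proof.
move=> ch /choice[M hM].
elim: d h ch M hM => [|d ih] h ch M hM.
  rewrite big_ord0 -[RHS](Rintegral_setT_cst (mu 0)).
  by apply: eq_Rintegral => y _; rewrite big_ord0.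
rewrite (@torus_integralS _ _ _ (\prod_i M i)); last 2 first.
- exact: measurable_prod_tnth.
- by move=> y; apply: prod_norm_le => i; exact: hM.
have mh' : measurable_fun setT (fun y : T d => \prod_i h (lift ord0 i) (tnth y i)).
  by apply: (@measurable_prod_tnth d (fun i => h (lift ord0 i))) => i; exact: ch.
rewrite big_ord_recl -(ih _ _ (fun i => M (lift ord0 i)))//.
rewrite -RintegralZr//; last by apply: unit_integral_continuous => //; exists (M ord0).
apply: eq_Rintegral => x _; rewrite -RintegralZl//; last first.
  apply: (@integrable_bounded _ _ _ _ _ (\prod_i M (lift ord0 i))) => // y.
  by apply: prod_norm_le => i; exact: hM.
apply: eq_Rintegral => y _; rewrite big_ord_recl; congr (h _ _ * _).
by apply: eq_bigr => i _; rewrite tnthS.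
Qed.

Lemma measurable_cos_tnth d (t : R) (k : 'I_d -> int) : measurable_fun setT
  (fun y : T d => cos (t + 2 * pi * \sum_i (k i)%:~R * tnth y i)).
Proof.
apply: (measurableT_comp (continuous_measurable_fun (@continuous_cos R))).
apply: measurable_funD => //; apply: measurable_funM => //.
apply: measurable_sum => i; apply: measurable_funM => //; exact: measurable_tnth.
Qed.

(** The free phase t makes the induction on d work: the first coordinate is absorbed in it while the
    others are integrated. *)
Lemma torus_integral_cos d (t : R) (k : 'I_d -> int) :
  \int[mu d]_y cos (t + 2 * pi * \sum_i (k i)%:~R * tnth y i) =
  [forall i, k i == 0]%:R * cos t.
Proof.
elim: d t k => [|d ih] t k.
  rewrite (_ : [forall i, _]) ?mul1r; last by apply/forallP => -[].
  rewrite -[RHS](Rintegral_setT_cst (mu 0)).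
  by apply: eq_Rintegral => y _; rewrite big_ord0 mulr0 addr0.
rewrite (torus_integralS (M := 1) (measurable_cos_tnth _ _))//; last by move=> y; exact: cos_max.
have E x : \int[mu d]_y cos (t + 2 * pi * \sum_i (k i)%:~R * tnth [tuple of x :: y] i) =
   [forall i, k (lift ord0 i) == 0]%:R * cos (t + 2 * pi * ((k ord0)%:~R * x)).
  rewrite -ih; apply: eq_Rintegral => y _; rewrite big_ord_recl; congr cos.
  rewrite mulrDr addrA; congr (_ + _ * _).
  by apply: eq_bigr => i _; rewrite tnthS.
under eq_Rintegral do rewrite E.
rewrite RintegralZl//; last first.
  apply: unit_integral_continuous; last by exists 1 => x; exact: cos_max.
  move=> x; have := is_derive_cos_affine t (2 * pi * (k ord0)%:~R) x.
  by under eq_fun do rewrite -mulrA; exact: is_derive_continuous.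
rewrite unit_integral_cos mulrA -natrM mulnb; congr (_%:R * _); congr nat_of_bool.
apply/andP/forallP => [[/forallP h h0] i|h]; last by split=> //; apply/forallP.
by case: (unliftP ord0 i) => [j|] -> //; exact: h.
Qed.

(** Telescoping from one product to the other, one factor at a time. *)
Lemma prod_diff_le n (A B : 'I_n -> R) : `|\prod_i A i - \prod_i B i| <=
  \sum_(j < n) \prod_(i < n) (if (i < j)%N then `|B i| else if i == j then `|A i - B i| else `|A i|).
Proof.
elim: n A B => [|n ih] A B; first by rewrite !big_ord0 subrr normr0.
rewrite !big_ord_recl.
have -> : A ord0 * \prod_(i < n) A (lift ord0 i) - B ord0 * \prod_(i < n) B (lift ord0 i) =
  (A ord0 - B ord0) * \prod_(i < n) A (lift ord0 i) +
  B ord0 * (\prod_(i < n) A (lift ord0 i) - \prod_(i < n) B (lift ord0 i)) by ring.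
rewrite (le_trans (ler_normD _ _))// lerD//.
- by rewrite normrM normr_prod.
- rewrite normrM; apply: (le_trans (ler_wpM2l (normr_ge0 _) (ih _ _))).
  rewrite mulr_sumr; apply/ler_sum => j _; rewrite big_ord_recl/=.
  rewrite ler_wpM2l//; apply/ler_prod => i _.
Qed.

End product_integrals.

Section Rintegral_finite_sums.
Context {d} {T : measurableType d} {R : realType} (mu : {measure set T -> \bar R}).

Lemma Rintegral_sumf (I : finType) (F : I -> T -> R) :
  (forall i, mu.-integrable setT (EFin \o F i)) ->
  mu.-integrable setT (EFin \o (fun y => \sum_i F i y)) /\
  \int[mu]_y (\sum_i F i y) = \sum_i \int[mu]_y F i y.
Proof.
move=> iF; rewrite -[\sum_i \int[mu]_y F i y]big_enum.
rewrite (_ : (fun y => \sum_i F i y) = fun y => \sum_(i <- enum I) F i y); last first.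
  by apply/funext => y; rewrite big_enum.
elim: (enum I) => [|i s [iis ih]].
  rewrite (_ : (fun y => _) = fun=> 0); last by apply/funext => y; rewrite big_nil.
  rewrite big_nil /Rintegral integral0; split => //; exact: integrable0.
rewrite (_ : (fun y => _) = fun y => F i y + \sum_(j <- s) F j y); last first.
  by apply/funext => y; rewrite big_cons.
rewrite big_cons -ih RintegralD//; split => //.
exact: (@integrableD _ _ _ mu setT measurableT (EFin \o F i) (EFin \o (fun y => \sum_(j <- s) F j y))).
Qed.

End Rintegral_finite_sums.

(** * Fourier multipliers as convolutions *)

Section fourier_multipliers.
Context {R : realType} {d : nat}.
Local Notation U := (@unit_measure R).
Local Notation mu := (@torus_measure R d).
Local Notation T := (d.-tuple (measurableTypeR R)).
Implicit Types (f g : 'rV[R]_d -> R) (k : 'rV[int]_d) (x : 'rV[R]_d) (n m N : nat).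

(** For bounded real f, the real part of the k-th term of the Fourier series; working with it keeps
    the rest of the proof free of complex numbers. *)
Definition mode_part f k x : R :=
  torus_int (fun y => f y * mode_cos k y) * mode_cos k x +
  torus_int (fun y => f y * mode_sin k y) * mode_sin k x.

Definition ess_bounded f (M : R) : Prop :=
  torus_measurable f /\ {ae mu, forall y, `|f (row_of y)| <= M}.

Lemma ess_bounded_integrable f M (h : T -> R) (B : R) : 0 <= M -> ess_bounded f M ->
  measurable_fun setT h -> (forall y, `|h y| <= B) ->
  mu.-integrable setT (EFin \o (fun y => f (row_of y) * h y)).
Proof.
move=> M0 [mf bf] mh bh; apply: (@integrable_ae_bounded _ _ _ _ _ (M * B)).
  exact: measurable_funM.
by apply: filterS bf => y My; rewrite normrM ler_pM.
Qed.

Lemma mode_cosE k (y : T) : mode_cos k (row_of y) = cos (0 + 2 * pi * \sum_i (k 0 i)%:~R * tnth y i).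
Proof. by rewrite add0r; congr (cos (_ * _)); apply: eq_bigr => i _; rewrite mxE. Qed.

Lemma mode_sinE k (y : T) : mode_sin k (row_of y) = cos (- (pi / 2) + 2 * pi * \sum_i (k 0 i)%:~R * tnth y i).
Proof.
rewrite [- _ + _]addrC cosBpihalf; congr (sin (_ * _)).
by apply: eq_bigr => i _; rewrite mxE.
Qed.

Lemma measurable_mode_cos k : measurable_fun setT (fun y : T => mode_cos k (row_of y)).
Proof. by under eq_fun do rewrite mode_cosE; exact: measurable_cos_tnth. Qed.

Lemma measurable_mode_sin k : measurable_fun setT (fun y : T => mode_sin k (row_of y)).
Proof. by under eq_fun do rewrite mode_sinE; exact: measurable_cos_tnth. Qed.

Lemma fourier_coefE f k M : 0 <= M -> ess_bounded f M -> fourier_coef f k =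
  Complex (torus_int (fun y => f y * mode_cos k y)) (- torus_int (fun y => f y * mode_sin k y)).
Proof.
move=> M0 fM; rewrite /fourier_coef /torus_cint; congr Complex.
  by apply: eq_Rintegral => y _ /=; rewrite mul0r subr0.
rewrite /torus_int -mulN1r -RintegralZl//; last first.
  exact: (ess_bounded_integrable M0 fM (measurable_mode_sin k) (fun y => sin_max _)).
by apply: eq_Rintegral => y _ /=; rewrite mul0r addr0 mulN1r -mulrN.
Qed.

Lemma fproj_mode_part N f x M : 0 <= M -> ess_bounded f M ->
  fproj N f x = \sum_(k \in modes N) mode_part f k x.
Proof.
move=> M0 fM; rewrite /fproj !sum_modes Re_sum; apply: eq_bigr => phi _.
by rewrite (fourier_coefE _ M0 fM)/= mulNr opprK.
Qed.

Lemma mode_cosB k x y : mode_cos k (x - y) = mode_cos k x * mode_cos k y + mode_sin k x * mode_sin k y.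
Proof.
rewrite /mode_cos /mode_sin -cosB -mulrBr; congr (cos (_ * _)).
by rewrite /dotZ -sumrB; apply: eq_bigr => i _; rewrite !mxE mulrBr.
Qed.

Lemma mode_part_conv f k x M : 0 <= M -> ess_bounded f M ->
  mu.-integrable setT (EFin \o (fun y => f (row_of y) * mode_cos k (x - row_of y))) /\
  mode_part f k x = \int[mu]_y (f (row_of y) * mode_cos k (x - row_of y)).
Proof.
move=> M0 fM.
have ic := ess_bounded_integrable M0 fM (measurable_mode_cos k) (fun y => cos_max _).
have is_ := ess_bounded_integrable M0 fM (measurable_mode_sin k) (fun y => sin_max _).
have ic' := integrableZr measurableT (mode_cos k x) ic.
have is' := integrableZr measurableT (mode_sin k x) is_.
have E y : f (row_of y) * mode_cos k (x - row_of y) =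
  f (row_of y) * mode_cos k (row_of y) * mode_cos k x + f (row_of y) * mode_sin k (row_of y) * mode_sin k x.
  by rewrite mode_cosB; ring.
split.
  under [X in EFin \o X]eq_fun do rewrite E.
  exact: (@integrableD _ _ _ mu setT measurableT _ _ ic' is').
under eq_Rintegral do rewrite E.
by rewrite RintegralD// !RintegralZr.
Qed.

(** The symbol is a tensor product cut off on a cube, so the convolution kernel is a product of
    one-dimensional kernels. [Pi_N], Fejer means and the truncated heat semigroup all have this
    shape. *)
Definition multiplier (w : nat -> R) n f x : R :=
  \sum_(k \in modes n) mode_weight w k * mode_part f k x.

Lemma multiplier_conv (w : nat -> R) n f x M : 0 <= M -> ess_bounded f M ->
  mu.-integrable setT (EFin \o (fun y => f (row_of y) * \prod_j ker w n (x 0 j - tnth y j))) /\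
  multiplier w n f x = \int[mu]_y (f (row_of y) * \prod_j ker w n (x 0 j - tnth y j)).
Proof.
move=> M0 fM.
have E y : f (row_of y) * \prod_j ker w n (x 0 j - tnth y j) =
  \sum_(phi : mode_box n) (f (row_of y) * mode_cos (box_mode phi) (x - row_of y)) * mode_weight w (box_mode phi).
  transitivity (f (row_of y) * \prod_j ker w n ((x - row_of y) 0 j)).
    by congr (_ * _); apply: eq_bigr => j _; rewrite !mxE.
  rewrite prod_ker sum_modes mulr_sumr; apply: eq_bigr => phi _; ring.
have ik k := (mode_part_conv k x M0 fM).1.
have ik' k := integrableZr measurableT (mode_weight w k) (ik k).
have [i1 i2] := Rintegral_sumf (fun phi : mode_box n => ik' (box_mode phi)).
split; first by under [X in EFin \o X]eq_fun do rewrite E.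
under eq_Rintegral do rewrite E.
rewrite i2 /multiplier sum_modes; apply: eq_bigr => phi _.
by rewrite RintegralZr// mulrC; congr (_ * _); have [] := mode_part_conv (box_mode phi) x M0 fM.
Qed.

Lemma norm_integral_le f M (h g : T -> R) : 0 <= M -> ess_bounded f M ->
  mu.-integrable setT (EFin \o (fun y => f (row_of y) * h y)) ->
  mu.-integrable setT (EFin \o g) -> (forall y, `|h y| <= g y) ->
  `|\int[mu]_y (f (row_of y) * h y)| <= M * \int[mu]_y g y.
Proof.
move=> M0 [mf bf] ih ig hg; rewrite -RintegralZl//.
apply: norm_Rintegral_le_ae => //.
- exact: (integrableZl measurableT M ig).
- by move=> y; rewrite mulr_ge0// (le_trans _ (hg y)).
- by apply: filterS bf => y My; rewrite normrM ler_pM.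
Qed.

Lemma integral_prod_l1 (h : 'I_d -> R -> R) (B : 'I_d -> R) x : (forall j, l1le (h j) (B j)) ->
  mu.-integrable setT (EFin \o (fun y : T => \prod_j `|h j (x 0 j - tnth y j)|)) /\
  \int[mu]_y (\prod_j `|h j (x 0 j - tnth y j)|) <= \prod_j B j.
Proof.
move=> hB; pose g j y := `|h j (x 0 j - y)|.
have cg j : continuous (g j).
  have := @continuous_reflect _ (fun y => `|h j y|) (x 0 j); apply.
  by apply: continuous_normr; exact: l1le_cont (hB j).
have bg j : exists M : R, forall y, `|g j y| <= M.
  by have [M hM] := l1le_bdd (hB j); exists M => y; rewrite normr_id.
split.
  have /choice[M hM] := bg.
  apply: (@integrable_bounded _ _ _ _ _ (\prod_j M j)).
    exact: (@measurable_prod_tnth _ _ g).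
  by move=> y; apply: (@prod_norm_le _ _ (fun j => g j (tnth y j))) => j; exact: hM.
rewrite (@torus_integral_prod _ _ g)//.
apply: ler_prod => j _; rewrite (l1le_int (hB j)) andbT.
by apply: Rintegral_ge0 => y _; rewrite normr_ge0.
Qed.

Lemma multiplier_bound (w : nat -> R) n f x M B : 0 <= M -> ess_bounded f M ->
  l1le (ker w n) B -> `|multiplier w n f x| <= M * B ^+ d.
Proof.
move=> M0 fM hB; have [i1 ->] := multiplier_conv w n x M0 fM.
have [i2 le2] := integral_prod_l1 x (fun=> hB).
apply: (le_trans (norm_integral_le M0 fM i1 i2 _)).
  by move=> y; rewrite normr_prod.
by rewrite ler_wpM2l// (le_trans le2)// prodr_const card_ord.
Qed.

(** The region between two cubes is not a product set. [prod_diff_le] splits the kernel into d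
    products, each with one band factor, of norm at most b, and other factors of norm at most L. *)
Lemma multiplier_band_bound (w : nat -> R) n m f x M L b : 0 <= M -> ess_bounded f M ->
  1 <= L -> l1le (ker w n) L -> l1le (ker w m) L ->
  l1le (fun t => ker w m t - ker w n t) b ->
  `|multiplier w m f x - multiplier w n f x| <= M * (d%:R * L ^+ d * b).
Proof.
move=> M0 fM L1 hn hm hb.
have [in_ ->] := multiplier_conv w n x M0 fM.
have [im ->] := multiplier_conv w m x M0 fM.
rewrite -RintegralB//.
pose C (j i : 'I_d) : R -> R := if (i < j)%N then ker w n else
  if i == j then (fun t => ker w m t - ker w n t) else ker w m.
pose B (j i : 'I_d) : R := if i == j then b else L.
have hC j i : l1le (C j i) (B j i).
  rewrite /C /B; case: ifP => [ij|_]; last by case: ifP.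
  by rewrite -val_eqE/= ltn_eqF.
have [ig leg] := Rintegral_sumf (fun j => (integral_prod_l1 x (hC j)).1).
have b0 := l1le_ge0 hb.
under eq_Rintegral do rewrite -mulrBr.
apply: (@le_trans _ _ (M * \int[mu]_y \sum_j \prod_i `|C j i (x 0 i - tnth y i)|)).
  apply: norm_integral_le => //.
    have := integrableB measurableT im in_.
    by rewrite (_ : (_ \- _)%E = EFin \o (fun y => f (row_of y) * (\prod_j ker w m (x 0 j - tnth y j) - \prod_j ker w n (x 0 j - tnth y j))))//; apply/funext => y /=; rewrite mulrBr EFinB.
  move=> y; apply: (le_trans (prod_diff_le _ _)).
  rewrite le_eqVlt; apply/predU1P; left; apply: eq_bigr => j _; apply: eq_bigr => i _.
  by rewrite /C; case: ifP => //; case: ifP.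
rewrite ler_wpM2l// leg.
apply: (@le_trans _ _ (\sum_(j < d) L ^+ d * b)); last first.
  by rewrite sumr_const card_ord mulr_natl mulrnAl.
apply: ler_sum => j _; apply: (le_trans (integral_prod_l1 x (hC j)).2).
rewrite (bigD1 j)//= /B eqxx mulrC ler_wpM2r//.
rewrite (eq_bigr (fun=> L)); last by move=> i /negbTE ->.
(* There are d - 1 factors L; as 1 <= L the power is rounded up to d. *)
rewrite prodr_const ler_weXn2l// -[leqRHS]card_ord; exact: max_card.
Qed.

End fourier_multipliers.

(** * Trigonometric polynomials and passage from Fejer means to projections *)

Section trigonometric_polynomials.
Context {R : realType} {d : nat}.
Local Notation mu := (@torus_measure R d).
Local Notation T := (d.-tuple (measurableTypeR R)).
Implicit Types (f g : 'rV[R]_d -> R) (k l : 'rV[int]_d) (x y : 'rV[R]_d) (n m N : nat).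

(** The phase covers sine and cosine at once and lets the product of two waves be half the sum of
    two waves. *)
Definition wave (t : R) k x : R := cos (t + 2 * pi * dotZ k x).

Inductive trig_poly n : ('rV[R]_d -> R) -> Prop :=
| trig_poly_wave t k : modes n k -> trig_poly n (wave t k)
| trig_poly_add f g : trig_poly n f -> trig_poly n g -> trig_poly n (fun x => f x + g x)
| trig_poly_scale c f : trig_poly n f -> trig_poly n (fun x => c * f x).

Lemma dotZD k l x : dotZ (k + l) x = dotZ k x + dotZ l x.
Proof. by rewrite /dotZ -big_split; apply: eq_bigr => i _; rewrite mxE rmorphD mulrDl. Qed.

Lemma dotZN k x : dotZ (- k) x = - dotZ k x.
Proof. by rewrite /dotZ -sumrN; apply: eq_bigr => i _; rewrite mxE rmorphN mulNr. Qed.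

Lemma mode_cos_wave k : mode_cos k = wave 0 k :> ('rV[R]_d -> R).
Proof. by apply/funext => x; rewrite /wave add0r. Qed.

Lemma mode_sin_wave k : mode_sin k = wave (- (pi / 2)) k :> ('rV[R]_d -> R).
Proof. by apply/funext => x; rewrite /wave addrC cosBpihalf. Qed.

Lemma trig_poly_ext n f g : f =1 g -> trig_poly n f -> trig_poly n g.
Proof. by move=> /funext ->. Qed.

Lemma modes0 n : @modes d n 0.
Proof. by move=> i; rewrite mxE. Qed.

Lemma trig_poly0 n : trig_poly n (fun=> 0).
Proof.
apply: (@trig_poly_ext _ (fun x => 0 * wave 0 0 x)) => [x|]; first by rewrite mul0r.
by apply: trig_poly_scale; apply: trig_poly_wave; exact: modes0.
Qed.

Lemma trig_poly_sum (I : finType) n (F : I -> 'rV[R]_d -> R) :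
  (forall i, trig_poly n (F i)) -> trig_poly n (fun x => \sum_i F i x).
Proof.
move=> hF; apply: (@trig_poly_ext _ (fun x => \sum_(i <- enum I) F i x)) => [x|].
  by rewrite big_enum.
elim: (enum I) => [|i s ih].
  by apply: (trig_poly_ext _ (trig_poly0 n)) => x; rewrite big_nil.
apply: (@trig_poly_ext _ (fun x => F i x + \sum_(j <- s) F j x)) => [x|].
  by rewrite big_cons.
exact: trig_poly_add.
Qed.

Lemma trig_poly_opp n f : trig_poly n f -> trig_poly n (fun x => - f x).
Proof.
by move=> hf; apply: (@trig_poly_ext _ (fun x => -1 * f x)) => [x|];
  [rewrite mulN1r|exact: trig_poly_scale].
Qed.

Lemma trig_poly_widen n m f : (n <= m)%N -> trig_poly n f -> trig_poly m f.
Proof.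
move=> nm; elim=> [t k kn|*|*]; [|exact: trig_poly_add|exact: trig_poly_scale].
by apply: trig_poly_wave => i; rewrite (le_trans (kn i))// lez_nat.
Qed.

Lemma trig_poly_mul n m f g : trig_poly n f -> trig_poly m g ->
  trig_poly (n + m) (fun x => f x * g x).
Proof.
move=> hf; elim: hf g => [t k kn|f1 f2 _ ih1 _ ih2|c f1 _ ih] g hg; last 2 first.
- apply: (@trig_poly_ext _ (fun x => f1 x * g x + f2 x * g x)) => [x|].
    by rewrite mulrDl.
  by apply: trig_poly_add; [exact: ih1|exact: ih2].
- apply: (@trig_poly_ext _ (fun x => c * (f1 x * g x))) => [x|]; first by rewrite mulrA.
  by apply: trig_poly_scale; exact: ih.
elim: hg => [s l lm|g1 g2 _ ih1 _ ih2|c g1 _ ih].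
- apply: (@trig_poly_ext _ (fun x => 2^-1 * (wave (t + s) (k + l) x + wave (t - s) (k - l) x))) => [x|].
    rewrite /wave !dotZD dotZN.
    have -> : t + s + 2 * pi * (dotZ k x + dotZ l x) =
      (t + 2 * pi * dotZ k x) + (s + 2 * pi * dotZ l x) by ring.
    have -> : t - s + 2 * pi * (dotZ k x - dotZ l x) =
      (t + 2 * pi * dotZ k x) - (s + 2 * pi * dotZ l x) by ring.
    by rewrite cosB cosD; field.
  apply: trig_poly_scale; apply: trig_poly_add; apply: trig_poly_wave => i;
    by rewrite !mxE (le_trans (ler_normD _ _))// ?normrN PoszD lerD// ?(kn i) ?(lm i).
- apply: (@trig_poly_ext _ (fun x => wave t k x * g1 x + wave t k x * g2 x)) => [x|].
    by rewrite mulrDr.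
  exact: trig_poly_add.
- apply: (@trig_poly_ext _ (fun x => c * (wave t k x * g1 x))) => [x|]; first by rewrite mulrCA.
  exact: trig_poly_scale.
Qed.

Lemma wave_row_of t k (y : T) :
  wave t k (row_of y) = cos (t + 2 * pi * \sum_i (k 0 i)%:~R * tnth y i).
Proof. by congr (cos (_ + _ * _)); apply: eq_bigr => i _; rewrite mxE. Qed.

Lemma torus_int_wave t k : torus_int (wave t k) = (k == 0)%:R * cos t.
Proof.
rewrite /torus_int; under eq_Rintegral do rewrite wave_row_of.
rewrite torus_integral_cos; congr (_%:R * _); congr nat_of_bool.
apply/forallP/eqP => [h|-> i]; last by rewrite mxE.
by apply/rowP => i; rewrite mxE; apply/eqP; exact: h.
Qed.

Lemma trig_poly_ess_bounded n f : trig_poly n f ->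
  exists2 M : R, 0 <= M & torus_measurable f /\ forall x, `|f x| <= M.
Proof.
elim=> [t k _|f1 f2 _ [M1 M10 [m1 b1]] _ [M2 M20 [m2 b2]]|c f1 _ [M1 M10 [m1 b1]]].
- exists 1 => //; split => [|x]; last exact: cos_max.
  rewrite /torus_measurable; under eq_fun do rewrite wave_row_of.
  exact: measurable_cos_tnth.
- exists (M1 + M2); first exact: addr_ge0.
  by split=> [|x]; [exact: measurable_funD|rewrite (le_trans (ler_normD _ _))// lerD].
- exists (`|c| * M1); first exact: mulr_ge0.
  by split=> [|x]; [exact: measurable_funM|rewrite normrM ler_wpM2l].
Qed.

Lemma bounded_ess_bounded f (M : R) : torus_measurable f -> (forall x, `|f x| <= M) -> ess_bounded f M.
Proof. by move=> mf bf; split => //; exact: aeW. Qed.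

(** A wave of frequency l is split evenly between the modes l and -l. For l = 0 both indicators are
    1, so the formula needs no separate case. *)
Lemma mode_part_wave t l k x :
  mode_part (wave t l) k x = 2^-1 * ((k == l)%:R + (k == - l)%:R) * wave t l x.
Proof.
have mw s h : torus_measurable (wave s h).
  rewrite /torus_measurable; under eq_fun do rewrite wave_row_of.
  exact: measurable_cos_tnth.
have iw s h : mu.-integrable setT (EFin \o (fun y : T => 2^-1 * wave s h (row_of y))).
  apply: (@integrable_bounded _ _ _ _ _ 2^-1); first by apply: measurable_funM => //; exact: mw.
  by move=> y; rewrite normrM ger0_norm ?invr_ge0// ler_piMr ?invr_ge0// cos_max.
have fb : ess_bounded (wave t l) 1.
  by apply: bounded_ess_bounded; [exact: mw|move=> y; exact: cos_max].
rewrite (mode_part_conv k x ler01 fb).2.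
have E (y : T) : wave t l (row_of y) * mode_cos k (x - row_of y) =
  2^-1 * wave (t + 2 * pi * dotZ k x) (l - k) (row_of y) +
  2^-1 * wave (t - 2 * pi * dotZ k x) (l + k) (row_of y).
  rewrite /wave /mode_cos !dotZD dotZN.
  have -> : dotZ k (x - row_of y) = dotZ k x - dotZ k (row_of y).
    by rewrite /dotZ -sumrB; apply: eq_bigr => i _; rewrite !mxE mulrBr.
  set a := dotZ k x; set b := dotZ l _; set c := dotZ k _.
  have -> : t + 2 * pi * a + 2 * pi * (b - c) = (t + 2 * pi * b) + 2 * pi * (a - c) by ring.
  have -> : t - 2 * pi * a + 2 * pi * (b + c) = (t + 2 * pi * b) - 2 * pi * (a - c) by ring.
  by move: (t + 2 * pi * b) (2 * pi * (a - c)) => p q; rewrite cosB cosD; field.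
under eq_Rintegral do rewrite E.
have iw' s h : mu.-integrable setT (EFin \o (fun y : T => wave s h (row_of y))).
  apply: (@integrable_bounded _ _ _ _ _ 1); first exact: mw.
  by move=> y; exact: cos_max.
rewrite RintegralD// !RintegralZl//.
have := torus_int_wave (t + 2 * pi * dotZ k x) (l - k); rewrite /torus_int => ->.
have := torus_int_wave (t - 2 * pi * dotZ k x) (l + k); rewrite /torus_int => ->.
rewrite subr_eq0 addr_eq0 [l == k]eq_sym -[l == - k](inj_eq oppr_inj) opprK [- l == k]eq_sym.
rewrite [2^-1 * (_ + _)]mulrDr [RHS]mulrDl -!(mulrA 2^-1); congr (_ * _ + _ * _).
- by have [->|_] := eqVneq k l; rewrite ?mulr0 ?mul0r.
- have [->|_] := eqVneq k (- l); rewrite ?mulr0 ?mul0r//.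
  by rewrite dotZN mulrN opprK.
Qed.

Lemma mode_part_add f g k x M : 0 <= M -> ess_bounded f M -> ess_bounded g M ->
  mode_part (fun y => f y + g y) k x = mode_part f k x + mode_part g k x.
Proof.
move=> M0 fM gM; rewrite /mode_part /torus_int.
have ic h (hM : ess_bounded h M) := ess_bounded_integrable M0 hM (measurable_mode_cos k) (fun y : T => cos_max _).
have is_ h (hM : ess_bounded h M) := ess_bounded_integrable M0 hM (measurable_mode_sin k) (fun y : T => sin_max _).
under eq_Rintegral do rewrite mulrDl.
rewrite RintegralD; [|by []|exact: ic|exact: ic].
under [X in _ + X * _ = _]eq_Rintegral do rewrite mulrDl.
rewrite RintegralD; [|by []|exact: is_|exact: is_].
by ring.
Qed.

Lemma mode_part_scale c f k x M : 0 <= M -> ess_bounded f M ->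
  mode_part (fun y => c * f y) k x = c * mode_part f k x.
Proof.
move=> M0 fM; rewrite /mode_part /torus_int.
have ic := ess_bounded_integrable M0 fM (measurable_mode_cos k) (fun y : T => cos_max _).
have is_ := ess_bounded_integrable M0 fM (measurable_mode_sin k) (fun y : T => sin_max _).
under eq_Rintegral do rewrite -mulrA.
rewrite RintegralZl//.
under [X in _ + X * _ = _]eq_Rintegral do rewrite -mulrA.
rewrite RintegralZl//; ring.
Qed.

Lemma ess_bounded_weaken f M B : M <= B -> ess_bounded f M -> ess_bounded f B.
Proof. by move=> MB [mf bf]; split=> //; apply: filterS bf => y /le_trans; apply. Qed.

Lemma sum_modes_delta n l : modes n l -> \sum_(k \in modes n) ((k == l)%:R : R) = 1.
Proof.
move=> /modesE[phi <-]; rewrite sum_modes (bigD1 phi)//= eqxx big1 ?addr0// => psi.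
by move=> /negbTE h; rewrite (inj_eq (@box_mode_inj _ _)) h.
Qed.

Lemma trig_poly_mode_part n f : trig_poly n f -> forall x,
  \sum_(k \in modes n) mode_part f k x = f x /\
  forall k, ~ modes n k -> mode_part f k x = 0.
Proof.
elim=> [t l ln|f1 f2 h1 ih1 h2 ih2|c f1 h1 ih1] x.
- have lnN : modes n (- l) by move=> i; rewrite mxE normrN.
  split=> [|k kn].
    rewrite sum_modes; under eq_bigr do rewrite mode_part_wave.
    rewrite -mulr_suml -mulr_sumr big_split/= -!(sum_modes n (fun k => ((k == _)%:R : R))).
    by rewrite !sum_modes_delta//; field.
  have nk h : modes n h -> (k == h) = false by move=> hn; apply/eqP => kh; apply: kn; rewrite kh.
  by rewrite mode_part_wave (nk _ ln) (nk _ lnN) addr0 mulr0 mul0r.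
- have [M1 M10 [m1 b1]] := trig_poly_ess_bounded h1.
  have [M2 M20 [m2 b2]] := trig_poly_ess_bounded h2.
  have M12 : 0 <= M1 + M2 by exact: addr_ge0.
  have e1 : ess_bounded f1 (M1 + M2).
    by apply: (@ess_bounded_weaken _ M1); [rewrite lerDl|exact: bounded_ess_bounded].
  have e2 : ess_bounded f2 (M1 + M2).
    by apply: (@ess_bounded_weaken _ M2); [rewrite lerDr|exact: bounded_ess_bounded].
  have [s1 z1] := ih1 x; have [s2 z2] := ih2 x.
  split=> [|k kn]; last by rewrite (mode_part_add _ _ M12)// z1// z2// addr0.
  rewrite sum_modes; under eq_bigr do rewrite (mode_part_add _ _ M12 e1 e2).
  by rewrite big_split/= -!(sum_modes n (fun k => mode_part _ k x)) s1 s2.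
- have [M1 M10 [m1 b1]] := trig_poly_ess_bounded h1.
  have e1 := bounded_ess_bounded m1 b1.
  have [s1 z1] := ih1 x.
  split=> [|k kn]; last by rewrite (mode_part_scale _ _ _ M10 e1) z1// mulr0.
  rewrite sum_modes; under eq_bigr do rewrite (mode_part_scale _ _ _ M10 e1).
  by rewrite -mulr_sumr -(sum_modes n (fun k => mode_part _ k x)) s1.
Qed.

Lemma trig_poly_fproj n N f : trig_poly N f -> (N <= n)%N -> forall x, fproj n f x = f x.
Proof.
move=> hf Nn x; have hf' := trig_poly_widen Nn hf.
have [M M0 [mf bf]] := trig_poly_ess_bounded hf.
rewrite (fproj_mode_part _ _ M0 (bounded_ess_bounded mf bf)).
exact: (trig_poly_mode_part hf' x).1.
Qed.

Lemma trig_poly_fproj_any n f M : 0 <= M -> ess_bounded f M -> trig_poly n (fproj n f).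
Proof.
move=> M0 fM; apply: (@trig_poly_ext _ (fun x => \sum_(phi : mode_box n) mode_part f (box_mode phi) x)) => [x|].
  by rewrite (fproj_mode_part _ _ M0 fM) sum_modes.
apply: trig_poly_sum => phi; have hm : modes n (box_mode phi) by apply/modesE; exists phi.
apply: trig_poly_add; apply: trig_poly_scale.
- by rewrite mode_cos_wave; exact: trig_poly_wave.
- by rewrite mode_sin_wave; exact: trig_poly_wave.
Qed.

Lemma sum_modes_widen n m (F : 'rV[int]_d -> R) : (n <= m)%N ->
  \sum_(k \in modes n) F k = \sum_(k \in modes m) (if k \in modes n then F k else 0).
Proof.
move=> nm; rewrite -fsbig_mkcondr; congr (\sum_(k \in _) _); apply/seteqP; split=> k.
- by move=> kn; split => // i; rewrite (le_trans (kn i))// lez_nat.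
- by case.
Qed.

Lemma one_sub_prod_le (I : finType) (a : I -> R) : (forall i, 0 <= a i <= 1) ->
  0 <= \prod_i a i <= 1 /\ 1 - \prod_i a i <= \sum_i (1 - a i).
Proof.
move=> ha; elim/big_ind2 : _ => [||]; first by rewrite ler01 lexx subrr.
- move=> p s q t [/andP[p0 p1] hp] [/andP[q0 q1] hq].
  by split; [rewrite mulr_ge0//= mulr_ile1|nra].
- by move=> i _; rewrite lexx; split => //; exact: ha.
Qed.

(** The Fejer mean of order m is at most M by [fejer_l1]. On the cube N its weights differ from 1 by
    at most d N / (m + 1); outside they lie in [0, 1], so those modes contribute at most tl. Letting
    m grow removes the first error. *)
Lemma fejer_sup_bound N f x (M tl : R) : 0 <= M -> ess_bounded f M ->
  (forall m, (N <= m)%N -> \sum_(k \in modes m) `|mode_part f k x| <=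
     \sum_(k \in modes N) `|mode_part f k x| + tl) ->
  `|fproj N f x| <= M + tl.
Proof.
move=> M0 fM htl; set S := \sum_(k \in modes N) `|mode_part f k x|.
have S0 : 0 <= S by apply: fsumr_ge0.
suff h m : (N <= m)%N -> `|fproj N f x| <= M + tl + d%:R * N%:R * S / m.+1%:R.
  apply/ler_addgt0Pr => e e0.
  have [m hm] : exists m, (N <= m)%N /\ d%:R * N%:R * S / m.+1%:R <= e.
    pose q := d%:R * N%:R * S / e; exists (maxn N (Num.truncn q)); split; first exact: leq_maxl.
    rewrite ler_pdivrMr// [leRHS]mulrC -ler_pdivrMr// -/q.
    have q1 : q <= (Num.truncn q).+1%:R by rewrite ltW// truncnS_gt.
    by rewrite (le_trans q1)// ler_nat ltnS leq_maxr.
  by apply: (le_trans (h m hm.1)); rewrite lerD2l hm.2.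
move=> Nm.
have hB := multiplier_bound x M0 fM (fejer_l1 m); rewrite expr1n mulr1 in hB.
have w01 i : (i <= m)%N -> 0 <= (fejer m i : R) <= 1.
  move=> im; apply/andP; split; last by rewrite /fejer gerBl divr_ge0.
  by rewrite /fejer subr_ge0 ler_pdivrMr// mul1r ler_nat leqW.
have diff : `|fproj N f x - multiplier (fejer m) m f x| <=
    tl + d%:R * N%:R * S / m.+1%:R.
  rewrite (fproj_mode_part _ _ M0 fM) (sum_modes_widen _ Nm) /multiplier !sum_modes -sumrB.
  apply: (le_trans (ler_norm_sum _ _ _)).
  have hk (phi : mode_box m) : (forall i : 'I_d, (absz (box_mode phi 0%R i) <= m)%N).
    move=> i; have : modes m (box_mode phi) by apply/modesE; exists phi.
    by move=> /(_ i); lia.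
  have bd (phi : mode_box m) : `|(if box_mode phi \in modes N then mode_part f (box_mode phi) x else 0) -
      mode_weight (fejer m) (box_mode phi) * mode_part f (box_mode phi) x| <=
      (`|mode_part f (box_mode phi) x| - (if box_mode phi \in modes N then `|mode_part f (box_mode phi) x| else 0)) +
      d%:R * N%:R / m.+1%:R * (if box_mode phi \in modes N then `|mode_part f (box_mode phi) x| else 0).
    have [/andP[p0 p1] ps] := one_sub_prod_le (fun j => w01 _ (hk phi j)).
    rewrite -/(mode_weight (fejer m) _) in p0 p1 ps.
    case: ifPn => [/set_mem kN|_].
      rewrite subrr add0r -{1}[mode_part _ _ _]mul1r -mulrBl normrM ler_wpM2r//.
      rewrite ger0_norm ?subr_ge0//; apply: (le_trans ps).
      apply: (@le_trans _ _ (\sum_(i < d) N%:R / m.+1%:R)).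
        apply: ler_sum => j _; rewrite /fejer opprB addrCA subrr addr0.
        by rewrite ler_pM2r ?invr_gt0// ler_nat; have := kN j; lia.
      by rewrite sumr_const card_ord -[leLHS]mulr_natl mulrA.
    by rewrite sub0r normrN mulr0 addr0 subr0 normrM ger0_norm// ler_piMl.
  apply: (le_trans (ler_sum _ (fun phi _ => bd phi))).
  rewrite big_split/= sumrB -mulr_sumr.
  rewrite -!(sum_modes m (fun k => if k \in modes N then `|mode_part f k x| else 0)).
  rewrite -(sum_modes_widen _ Nm) -(sum_modes m (fun k => `|mode_part f k x|)) -/S.
  apply: lerD; first by have := htl m Nm; rewrite -/S; lra.
  by rewrite mulrAC.
rewrite -[fproj N f x](subrK (multiplier (fejer m) m f x)).
by rewrite (le_trans (ler_normD _ _))// -addrA addrC lerD.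
Qed.

(** The previous bound with tl = 0, as f has no mode outside the cube. It turns the L^infinity norm
    of Pi_N u_0 into a pointwise bound, which the maximum principle requires. *)
Lemma trig_poly_ess_bound n f M : 0 <= M -> trig_poly n f -> ess_bounded f M ->
  forall x, `|f x| <= M.
Proof.
move=> M0 hf fM x; rewrite -(trig_poly_fproj hf (leqnn n)) -[leRHS]addr0.
apply: fejer_sup_bound => // m nm; rewrite addr0 (sum_modes_widen _ nm).
have [_ h] := trig_poly_mode_part hf x.
rewrite !sum_modes; apply: ler_sum => phi _; case: ifPn => // /negP kn.
rewrite h ?normr0// => kn'; apply: kn; exact: mem_set.
Qed.

End trigonometric_polynomials.

(** * Lattice sums and initial data in H^s *)

Section lattice_tail.
Context {R : realType} {d : nat}.
Implicit Types (k : 'rV[int]_d) (n m N : nat).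

Definition bracket k : R := 1 + \sum_i ((k 0 i)%:~R ^+ 2).

Lemma bracket_gt0 k : 0 < bracket k.
Proof. by rewrite /bracket ltr_wpDr// sumr_ge0// => i _; exact: sqr_ge0. Qed.

Lemma bracket_lower n k : ~ modes n k -> n%:R ^+ 2 <= bracket k.
Proof.
move=> /existsNP[i /negP]; rewrite -ltNge => ni.
rewrite /bracket (bigD1 i)//= addrCA ler_wpDr//.
  by rewrite addr_ge0// sumr_ge0// => j _; exact: sqr_ge0.
rewrite -(@real_normK _ (k 0 i)%:~R) ?num_real// lerXn2r ?nnegrE//.
by rewrite -intr_norm -[n%:R]/(n%:Z%:~R) ler_int ltW.
Qed.

Lemma bracket_powR_lower n k (s : R) : 0 <= s -> ~ modes n k ->
  n%:R `^ (2 * s) <= bracket k `^ s.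
Proof.
move=> s0 kn; rewrite powRrM powR_mulrn//.
by apply: ge0_ler_powR; rewrite ?nnegrE ?sqr_ge0 ?(ltW (bracket_gt0 k))// bracket_lower.
Qed.

Lemma card_mode_box n : #|{: @mode_box d n}| = ((2 * n).+1 ^ d)%N.
Proof. by rewrite card_ffun !card_ord. Qed.

(** The cube of radius 2n has (4n + 1)^d <= (5n)^d points, and each point outside the cube of radius
    n contributes at most n^(-2s). *)
Lemma lattice_shell (s : R) n : 0 <= s -> (0 < n)%N ->
  \sum_(k \in modes (2 * n)) (bracket k `^ s)^-1 <=
  \sum_(k \in modes n) (bracket k `^ s)^-1 + 5 ^+ d * n%:R `^ (- (2 * s - d%:R)).
Proof.
move=> s0 n0; have n0R : n%:R != 0 :> R by rewrite pnatr_eq0 -lt0n.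
rewrite -lerBlDl (@sum_modes_widen _ _ n (2 * n)%N) ?leq_pmull// !sum_modes -sumrB.
apply: (@le_trans _ _ (\sum_(phi : @mode_box d (2 * n)) n%:R `^ (- (2 * s)))).
  apply: ler_sum => phi _; case: ifPn => [_|/negP kn]; first by rewrite subrr powR_ge0.
  rewrite subr0 powRN lef_pV2 ?posrE ?powR_gt0 ?bracket_gt0 ?ltr0n//.
  by apply: bracket_powR_lower => // kn'; apply: kn; exact: mem_set.
rewrite sumr_const card_mode_box opprB [d%:R - _]addrC powRD ?n0R ?implybT//.
rewrite powR_mulrn// mulrCA -exprMn -[leLHS]mulr_natr ler_wpM2l ?powR_ge0// natrX.
rewrite lerXn2r ?nnegrE ?mulr_ge0// -natrM ler_nat; lia.
Qed.

Lemma lattice_tail (s : R) : d%:R / 2 < s -> exists2 C : R, 0 <= C &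
  forall n m, (0 < n)%N -> \sum_(k \in modes m) (bracket k `^ s)^-1 <=
    \sum_(k \in modes n) (bracket k `^ s)^-1 + C * n%:R `^ (- (2 * s - d%:R)).
Proof.
move=> ds; set e := 2 * s - d%:R.
have e0 : 0 < e by rewrite /e; lra.
have s0 : 0 <= s by apply: le_trans (ltW ds); rewrite divr_ge0.
pose q : R := 2 `^ (- e).
have q1 : q < 1.
  have := @gt0_ltr_powR R e e0 1 2; rewrite !nnegrE powR1 => /(_ ler01 (ler0n _ _) (ltr1n _ _)).
  by rewrite /q powRN invf_lt1 ?powR_gt0.
(* The solution of 5^d + q C = C: one shell plus the tail from 2n, whose size is scaled by q. *)
pose C : R := 5 ^+ d / (1 - q).
have C0 : 0 <= C by rewrite /C divr_ge0 ?exprn_ge0// subr_ge0 ltW.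
exists C => // n m n0.
have dy J : forall n, (0 < n)%N -> \sum_(k \in modes (2 ^ J * n)) (bracket k `^ s)^-1 <=
    \sum_(k \in modes n) (bracket k `^ s)^-1 + C * n%:R `^ (- e).
  elim: J => [|J ih] {n0}n n0; first by rewrite mul1n lerDl mulr_ge0// powR_ge0.
  rewrite expnSr -mulnA; apply: (le_trans (ih _ _)); first by rewrite muln_gt0.
  have := lattice_shell s0 n0; rewrite -/e.
  rewrite natrM powRM// -/q.
  have -> : 5 ^+ d = C * (1 - q) by rewrite /C divfK// subr_eq0 gt_eqF.
  by lra.
(* As m <= 2^m n, m doublings are enough to cover the cube of radius m. *)
apply: le_trans (dy m n n0).
have mle : (m <= 2 ^ m * n)%N by apply: leq_trans (leq_pmulr _ n0); exact/ltnW/ltn_expl.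
rewrite (sum_modes_widen _ mle) !sum_modes; apply: ler_sum => phi _.
by case: ifP => // _; rewrite invr_ge0 powR_ge0.
Qed.

End lattice_tail.

Section sobolev_sup_bound.
Context {R : realType} {d : nat}.
Implicit Types (f : 'rV[R]_d -> R) (k : 'rV[int]_d) (x : 'rV[R]_d) (n m N : nat).

Lemma finite_modes n : finite_set (@modes d n).
Proof.
rewrite (_ : modes n = [set box_mode phi | phi in [set: mode_box n]]).
  by apply: finite_image; exact: finite_finset.
by apply/seteqP; split=> k => [/modesE[phi <-]|[phi _ <-]]; [exists phi|apply/modesE; exists phi].
Qed.

Lemma mode_part_sqr_le f k x M : 0 <= M -> ess_bounded f M ->
  mode_part f k x ^+ 2 <= complex.Re (fourier_coef f k) ^+ 2 + complex.Im (fourier_coef f k) ^+ 2.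
Proof.
move=> M0 fM; rewrite (fourier_coefE _ M0 fM)/= sqrrN /mode_part.
set a := torus_int _; set b := torus_int _.
have cs : mode_cos k x ^+ 2 + mode_sin k x ^+ 2 = 1 by exact: cos2Dsin2.
have -> : a ^+ 2 + b ^+ 2 = (a ^+ 2 + b ^+ 2) * (mode_cos k x ^+ 2 + mode_sin k x ^+ 2) by rewrite cs mulr1.
have := sqr_ge0 (a * mode_sin k x - b * mode_cos k x); nra.
Qed.

Lemma Hs_sum_le (s : R) f m : (Hs_sqnorm s f < +oo)%E ->
  \sum_(k \in modes m) (bracket k `^ s *
    (complex.Re (fourier_coef f k) ^+ 2 + complex.Im (fourier_coef f k) ^+ 2)) <=
  fine (Hs_sqnorm s f).
Proof.
move=> Hoo; rewrite -lee_fin fineK; last first.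
  rewrite ge0_fin_numE//; apply: esum_ge0 => k _.
  by rewrite lee_fin mulr_ge0 ?powR_ge0// addr_ge0 ?sqr_ge0.
rewrite -fsumEFin; last exact: finite_modes.
by apply: ereal_sup_ubound; exists (modes m) => //; split => //; exact: finite_modes.
Qed.

Lemma young_weighted (p v : R) : 0 < p -> `|v| <= 2^-1 * (p * v ^+ 2 + p^-1).
Proof.
move=> p0; rewrite -[v ^+ 2]real_normK ?num_real//.
have p1 : p * p^-1 = 1 by rewrite mulfV// gt_eqF.
have pV : 0 < p^-1 by rewrite invr_gt0.
have := mulr_ge0 (ltW pV) (sqr_ge0 (p * `|v| - 1)).
have -> : p^-1 * (p * `|v| - 1) ^+ 2 = p * `|v| ^+ 2 * (p * p^-1) - 2 * `|v| * (p * p^-1) + p^-1 by ring.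
rewrite p1; lra.
Qed.

(** The absolute tail required by [fejer_sup_bound] is estimated mode by mode with [young_weighted],
    taking p = e (1 + |k|^2)^s. *)
Lemma sobolev_fproj_sup (s : R) f (M : R) : 0 <= M -> ess_bounded f M -> d%:R / 2 < s ->
  (Hs_sqnorm s f < +oo)%E -> exists2 C : R, 0 <= C &
  forall N x, (0 < N)%N -> `|fproj N f x| <= M + C * N%:R `^ (- (s - d%:R / 2)).
Proof.
move=> M0 fM ds Hoo; have [C C0 hC] := lattice_tail ds.
set H := fine (Hs_sqnorm s f).
have H0 : 0 <= H.
  apply: fine_ge0; apply: esum_ge0 => k _.
  by rewrite lee_fin mulr_ge0 ?powR_ge0// addr_ge0 ?sqr_ge0.
exists (2^-1 * (H + C)) => [|N x N0]; first by rewrite mulr_ge0// addr_ge0.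
apply: fejer_sup_bound => // m Nm.
(* This e balances the two halves: the lattice tail is C e^2, so e H and e^-1 C e^2 have the same
   order. *)
set e := N%:R `^ (- (s - d%:R / 2)).
have e0 : 0 < e by rewrite powR_gt0// ltr0n.
have ee : N%:R `^ (- (2 * s - d%:R)) = e * e.
  rewrite -powRD; last by rewrite pnatr_eq0 -lt0n N0 implybT.
  by congr (_ `^ _); field.
pose b k := complex.Re (fourier_coef f k) ^+ 2 + complex.Im (fourier_coef f k) ^+ 2.
rewrite -lerBlDl (sum_modes_widen _ Nm) !sum_modes -sumrB.
apply: (@le_trans _ _ (\sum_(phi : @mode_box d m) (2^-1 * e * (bracket (box_mode phi) `^ s * b (box_mode phi)) +
   2^-1 * e^-1 * ((bracket (box_mode phi) `^ s)^-1 - (if box_mode phi \in modes N then (bracket (box_mode phi) `^ s)^-1 else 0))))).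
  apply: ler_sum => phi _; set k := box_mode phi.
  have q0 : 0 < bracket k `^ s :> R by rewrite powR_gt0 ?bracket_gt0.
  have b0 : 0 <= b k by rewrite addr_ge0 ?sqr_ge0.
  case: ifP => _.
    by rewrite !subrr mulr0 addr0 mulr_ge0// ?mulr_ge0// ltW.
  rewrite !subr0; apply: (le_trans (young_weighted _ (mulr_gt0 e0 q0))).
  rewrite invfM mulrDr !mulrA lerD2r -!mulrA !ler_wpM2l//; [exact: ltW|exact: ltW|].
  exact: mode_part_sqr_le fM.
rewrite big_split/= -!mulr_sumr sumrB.
rewrite -(sum_modes m (fun k => bracket k `^ s * b k)).
rewrite -(sum_modes m (fun k => (bracket k `^ s)^-1)) -(sum_modes m (fun k => if k \in modes N then (bracket k `^ s)^-1 else 0)).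
rewrite -(sum_modes_widen _ Nm).
have h1 := Hs_sum_le m Hoo; rewrite -/H in h1.
have h2 := hC N m N0; rewrite ee -lerBlDl in h2.
have h3 : e^-1 * (C * (e * e)) = C * e by rewrite mulrCA mulKf ?gt_eqF.
have eV : 0 <= e^-1 by rewrite invr_ge0 ltW.
have h4 := ler_wpM2l eV h2; rewrite h3 in h4.
have h5 : e * \sum_(k \in modes m) (bracket k `^ s * b k) <= e * H by rewrite ler_wpM2l// ltW.
rewrite -!mulrA -mulrDr ler_pM2l//; lra.
Qed.

End sobolev_sup_bound.

(** * Derivative tests at a maximum *)

Section one_variable_tests.
Context {R : realType}.
Implicit Types (f g : R -> R).

Lemma derive_pos_quotient f (x : R) : derivable f x 1 -> 0 < 'D_1 f x ->
  exists2 e : R, 0 < e & forall h, 0 < `|h| < e -> 0 < h^-1 * (f (x + h) - f x).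
Proof.
move=> df Lp.
have : \forall h \near 0^', 0 < h^-1 *: ((f \o shift x) (h *: (1 : R)) - f x).
  exact: (cvgr_gt _ df).
move=> /nbhs_ballP[e /= e0 he]; exists e => // h /andP[h0 hlt].
have := he h; rewrite /ball/= sub0r normrN -normr_gt0 => /(_ hlt h0).
by rewrite /GRing.scale/= mulr1 [h + x]addrC.
Qed.

(** One-sided on purpose: the maximum over [0, T] may be attained at the final time. *)
Lemma derive_left_max_ge0 f (x a : R) : a < x -> derivable f x 1 ->
  (forall y, a <= y <= x -> f y <= f x) -> 0 <= 'D_1 f x.
Proof.
move=> ax df fmax; rewrite leNgt; apply/negP => D0.
have dN : derivable (fun y => - f y) x 1 by exact: derivableN.
have DN : 'D_1 (fun y => - f y) x = - 'D_1 f x by rewrite -deriveN.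
have [|e e0 he] := derive_pos_quotient dN; first by rewrite DN oppr_gt0.
pose h := Num.min (e / 2) (x - a).
have h0 : 0 < h by rewrite lt_min divr_gt0// subr_gt0.
have he2 : h <= e / 2 by rewrite ge_min lexx.
have hxa : h <= x - a by rewrite ge_min lexx orbT.
have := he (- h); rewrite normrN gtr0_norm// h0 /= => /(_ ltac:(lra)).
rewrite invrN mulNr oppr_gt0 pmulr_rlt0 ?invr_gt0//.
have : f (x - h) <= f x by apply: fmax; lra.
lra.
Qed.

(** The second derivative is available at one point only, without continuity. If it were positive
    there, f' would be positive just to the right of 0 and the mean value theorem would give a
    larger value. *)
Lemma derive2_max_le0 f : (forall x, derivable f x 1) -> derivable ('D_1 f) 0 1 ->
  (forall x, f x <= f 0) -> 'D_1 ('D_1 f) 0 <= 0.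
Proof.
move=> df d2f fmax; rewrite leNgt; apply/negP => D0.
have f1 : 'D_1 f 0 = 0.
  have h0 : (0 : R) \in `]-1, 1[ by rewrite in_itv/= ltrN10 ltr01.
  have [_ //] := @derive1_at_max R f (-1) 1 0 ltac:(lra) (fun t _ => df t) h0 (fun t _ => fmax t).
have [e e0 he] := derive_pos_quotient d2f D0.
have e20 : 0 < e / 2 by lra.
have dfx x : x \in `]0, e / 2[ -> is_derive x 1 f ('D_1 f x) by move=> _; exact: DeriveDef (df x) erefl.
have cf : {within `[0, e / 2], continuous f} by apply: derivable_within_continuous => x _; exact: df.
have [c /[!in_itv]/= /andP[c0 ce] fE] := MVT e20 dfx cf.
have := he c; rewrite gtr0_norm// f1 subr0 add0r c0 /= => /(_ ltac:(lra)).
rewrite pmulr_rgt0 ?invr_gt0// => Dc.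
have := fmax (e / 2); have : 0 < 'D_1 f c * (e / 2 - 0) by rewrite subr0 mulr_gt0.
rewrite -fE; lra.
Qed.

End one_variable_tests.

Section directional_derivatives.
Context {R : realType} {d : nat}.
Implicit Types (f : 'rV[R]_d -> R) (x v : 'rV[R]_d).

Lemma line_quotient f x v (s : R) :
  (fun h => h^-1 *: (((fun r : R => f (x + r *: v)) \o shift s) (h *: (1 : R)) - f (x + s *: v))) =
  (fun h => h^-1 *: ((f \o shift (x + s *: v)) (h *: v) - f (x + s *: v))).
Proof.
apply/funext => h /=; congr (_ *: (f _ - _)).
have -> : h *: (1 : R) = h by rewrite /GRing.scale/= mulr1.
by rewrite scalerDl addrCA.
Qed.

Lemma derivable_line f x v s : derivable (fun r : R => f (x + r *: v)) s 1 <-> derivable f (x + s *: v) v.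
Proof. by rewrite /derivable line_quotient. Qed.

Lemma derive_line f x v s : 'D_1 (fun r : R => f (x + r *: v)) s = 'D_v f (x + s *: v).
Proof. by rewrite /derive line_quotient. Qed.

Lemma directional_second_max f x v : (forall y, derivable f y v) ->
  derivable ('D_v f) x v -> (forall y, f y <= f x) -> 'D_v ('D_v f) x <= 0.
Proof.
move=> df d2f fmax.
pose g r := f (x + r *: v).
have D1 : 'D_1 g = fun r => 'D_v f (x + r *: v) by apply/funext => r; exact: derive_line.
have xE : x = x + 0 *: v by rewrite scale0r addr0.
have -> : 'D_v ('D_v f) x = 'D_1 ('D_1 g) 0 by rewrite D1 (derive_line ('D_v f)) -xE.
apply: derive2_max_le0.
- by move=> r; apply/derivable_line; exact: df.
- by rewrite D1; apply: (derivable_line ('D_v f) x v 0).2; rewrite -xE.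
- by move=> r; rewrite /g -xE.
Qed.

Lemma is_derive_line f x v l : is_derive (0 : R) 1 (fun r : R => f (x + r *: v)) l -> is_derive x v f l.
Proof.
move=> [/derivable_line + <-]; rewrite derive_line scale0r addr0 => df.
exact: DeriveDef.
Qed.

Lemma laplacian_max_le0 f x :
  (forall i y, derivable f y (delta_mx 0 i)) ->
  (forall i, derivable ('D_(delta_mx 0 i) f) x (delta_mx 0 i)) ->
  (forall y, f y <= f x) -> laplacian f x <= 0.
Proof.
move=> df d2f fmax; apply: sumr_le0 => i _; apply: directional_second_max => //.
Qed.

End directional_derivatives.

(** * Reduction to the compact unit cube *)

Section periodic_reduction.
Context {R : realType} {d : nat}.
Implicit Types (f : 'rV[R]_d -> R) (x : 'rV[R]_d).

Lemma periodic_nat f i (n : nat) x : torus_periodic f -> f (x + n%:R *: delta_mx 0 i) = f x.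
Proof.
move=> pf; elim: n => [|n ih]; first by rewrite scale0r addr0.
by rewrite -natr1 scalerDl scale1r addrA pf.
Qed.

Lemma periodic_int f i (z : int) x : torus_periodic f -> f (x + z%:~R *: delta_mx 0 i) = f x.
Proof.
move=> pf; case: z => n; first exact: periodic_nat.
rewrite NegzE mulrNz scaleNr -[in RHS](subrK (n.+1%:R *: delta_mx 0 i) x).
by rewrite [in RHS]periodic_nat.
Qed.

Lemma periodic_shift f (z : 'I_d -> int) x : torus_periodic f ->
  f (x + \sum_i (z i)%:~R *: delta_mx 0 i) = f x.
Proof.
move=> pf; elim/big_rec : _ x => [x|i y _ ih x]; first by rewrite addr0.
by rewrite addrA ih periodic_int.
Qed.

Definition unit_cube : set 'rV[R]_d := [set x | forall i, `[0, 1]%classic (x ord0 i)].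

Lemma unit_cube_compact : compact unit_cube.
Proof. by apply: (@rV_compact R d (fun=> `[0, 1]%classic)) => i; exact: segment_compact. Qed.

Lemma periodic_unit_cube x : exists2 y : 'rV[R]_d, unit_cube y &
  forall f, torus_periodic f -> f x = f y.
Proof.
exists (x + \sum_i (- Num.floor (x 0 i))%:~R *: delta_mx 0 i).
  move=> i /=; rewrite mxE summxE (bigD1 i)//= big1; last first.
    by move=> j ji; rewrite !mxE eqxx eq_sym (negbTE ji) mulr0.
  rewrite !mxE !eqxx mulr1 addr0 mulrNz in_itv/=.
  by have /andP[] := real_floor_itv (num_real (x 0 i)); rewrite intrD1; lra.
by move=> f pf; rewrite periodic_shift.
Qed.

End periodic_reduction.

(** * Maximum principle and uniqueness for the heat equation *)

Section heat_equation.
Context {R : realType} {d : nat}.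
Local Notation e_ i := (delta_mx 0 i : 'rV[R]_d).
Implicit Types (w S : R -> 'rV[R]_d -> R) (f g : 'rV[R]_d -> R) (x : 'rV[R]_d) (t T m : R).

(** The differential inequality is asked only where w exceeds m, which is where the sign of the
    nonlinearity is known. At a maximum of w - eta t the time derivative of w is at least eta > 0,
    whereas the Laplacian is at most 0. *)
Lemma maximum_principle (nu2 : R) w T m : 0 <= nu2 ->
  (forall t, 0 <= t <= T -> torus_periodic (w t)) ->
  continuous (fun p : R * 'rV[R]_d => w (Num.max p.1 0) p.2) ->
  (forall x, w 0 x <= m) ->
  (forall t x, 0 < t <= T -> m < w t x ->
    [/\ derivable (fun r => w r x) t 1,
        forall i y, derivable (w t) y (e_ i),
        forall i, derivable ('D_(e_ i) (w t)) x (e_ i) &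
        derive1 (fun r => w r x) t <= nu2 * laplacian (w t) x]) ->
  forall t x, 0 <= t <= T -> w t x <= m.
Proof.
move=> nu0 pw cw w0 hw t1 x1 /andP[t10 t1T]; rewrite leNgt; apply/negP => mw.
have {}t10 : 0 < t1.
  rewrite lt_neqAle t10 andbT; apply/eqP => t0; move: mw; rewrite -t0 ltNge w0 //.
(* Half of the excess over m survives at (t1, x1), so the maximum of w - eta t is above m; this
   forces t0 > 0 and w > m there. *)
pose eta := (w t1 x1 - m) / (2 * t1).
have eta0 : 0 < eta by rewrite divr_gt0 ?mulr_gt0// subr_gt0.
have etat : eta * t1 = (w t1 x1 - m) / 2 by rewrite /eta; field; rewrite gt_eqF.
pose K : set (R * 'rV[R]_d) := `[0, T]%classic `*` unit_cube.
pose phi (p : R * 'rV[R]_d) := w (Num.max p.1 0) p.2 - eta * p.1.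
have cphi : continuous phi.
  move=> p; apply: cvgB; first exact: cw.
  by apply: cvgM; [exact: cvg_cst|exact: cvg_fst].
have K0 : K !=set0.
  have [y1 y1c _] := periodic_unit_cube x1.
  by exists (t1, y1); split => //=; rewrite in_itv/= ltW.
have KC : compact K by apply: compact_setX; [exact: segment_compact|exact: unit_cube_compact].
have [[t0 x0] /set_mem[/= /[!in_itv]/= /andP[t00 t0T] x0c] pmax] :=
  compact_EVT_max K0 KC (continuous_subspaceT cphi).
have mx t y : 0 <= t <= T -> w t y - eta * t <= w t0 x0 - eta * t0.
  move=> /[dup] tT /andP[ta tb].
  have [y' y'c yE] := periodic_unit_cube y.
  have := pmax (t, y'); rewrite /phi/= (max_idPl ta) (max_idPl t00) -yE; last exact: pw.
  by apply; apply/mem_set; split => //=; rewrite in_itv.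
have h1 := mx t1 x1; rewrite etat ltW//= t1T in h1; have {}h1 := h1 isT.
have wt0 : m < w t0 x0 - eta * t0 by lra.
have t0p : 0 < t0.
  rewrite lt_neqAle t00 andbT; apply/eqP => z; move: wt0; rewrite -z mulr0 subr0 ltNge w0 //.
have mwt : m < w t0 x0 by rewrite (lt_le_trans wt0)// gerBl mulr_ge0// ltW.
have [||dt dx d2x eq] := hw t0 x0; [by rewrite t0p|by []|].
have lap : laplacian (w t0) x0 <= 0.
  apply: laplacian_max_le0 => // y.
  by have := mx t0 y; rewrite lerD2r; apply; rewrite t00.
have dphi := is_derive_sub (DeriveDef dt erefl) (is_derive_scale eta (is_derive_idf t0)).
have : 0 <= 'D_1 (fun r => w r x0 - eta * r) t0.
  have [dd _] := dphi; apply: (derive_left_max_ge0 t0p dd).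
  by move=> y /andP[ya yb]; apply: mx; rewrite ya (le_trans yb).
have [_ ->] := dphi; rewrite -derive1E mulr1 => h2.
have : nu2 * laplacian (w t0) x0 <= 0 by rewrite mulr_ge0_le0.
lra.
Qed.

(** Replacing t by max(t, 0) freezes w at negative times; continuity up to t = 0 then becomes plain
    continuity on the whole space. *)
Record heat (nu2 : R) w S : Prop := Heat {
  heat_periodic : forall t, 0 <= t -> torus_periodic (w t);
  heat_continuous : continuous (fun p : R * 'rV[R]_d => w (Num.max p.1 0) p.2);
  heat_dt : forall t x, 0 < t -> derivable (fun r => w r x) t 1;
  heat_dx : forall t x i, 0 < t -> derivable (w t) x (e_ i);
  heat_dxx : forall t x i, 0 < t -> derivable ('D_(e_ i) (w t)) x (e_ i);
  heat_eq : forall t x, 0 < t ->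
    derive1 (fun r => w r x) t = nu2 * laplacian (w t) x + S t x }.

Lemma derive_dirD f g i : (forall x, derivable f x (e_ i)) -> (forall x, derivable g x (e_ i)) ->
  'D_(e_ i) (fun y => f y + g y) = (fun y => 'D_(e_ i) f y + 'D_(e_ i) g y).
Proof. by move=> df dg; apply/funext => y; exact: (deriveD (df y) (dg y)). Qed.

Lemma derive_dirZ f (c : R) i : (forall x, derivable f x (e_ i)) ->
  'D_(e_ i) (fun y => c * f y) = (fun y => c * 'D_(e_ i) f y).
Proof. by move=> df; apply/funext => y; exact: (deriveZ c (df y)). Qed.

Lemma heat_add nu2 w1 w2 S1 S2 : heat nu2 w1 S1 -> heat nu2 w2 S2 ->
  heat nu2 (fun t x => w1 t x + w2 t x) (fun t x => S1 t x + S2 t x).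
Proof.
move=> [p1 c1 dt1 dx1 dxx1 e1] [p2 c2 dt2 dx2 dxx2 e2]; split.
- by move=> t t0 x i; rewrite p1// p2.
- by move=> p; apply: cvgD; [exact: c1|exact: c2].
- by move=> t x t0; exact: derivableD (dt1 _ _ t0) (dt2 _ _ t0).
- by move=> t x i t0; exact: derivableD (dx1 _ _ _ t0) (dx2 _ _ _ t0).
- move=> t x i t0; rewrite derive_dirD => [|y|y]; [|exact: dx1|exact: dx2].
  exact: derivableD (dxx1 _ _ _ t0) (dxx2 _ _ _ t0).
- move=> t x t0; rewrite derive1E.
  have -> := deriveD (dt1 t x t0) (dt2 t x t0); rewrite -!derive1E e1// e2//.
  have -> : laplacian (fun y => w1 t y + w2 t y) x = laplacian (w1 t) x + laplacian (w2 t) x.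
    rewrite /laplacian -big_split/=; apply: eq_bigr => i _.
    rewrite derive_dirD => [|y|y]; [|exact: dx1|exact: dx2].
    exact: deriveD (dxx1 _ _ _ t0) (dxx2 _ _ _ t0).
  by rewrite mulrDr addrACA.
Qed.

Lemma heat_scale nu2 (c : R) w S : heat nu2 w S ->
  heat nu2 (fun t x => c * w t x) (fun t x => c * S t x).
Proof.
move=> [p1 c1 dt1 dx1 dxx1 e1]; split.
- by move=> t t0 x i; rewrite p1.
- by move=> p; apply: cvgM; [exact: cvg_cst|exact: c1].
- by move=> t x t0; exact: derivableZ (dt1 _ _ t0).
- by move=> t x i t0; exact: derivableZ (dx1 _ _ _ t0).
- move=> t x i t0; rewrite derive_dirZ => [|y]; [|exact: dx1].
  exact: derivableZ (dxx1 _ _ _ t0).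
- move=> t x t0; rewrite derive1E.
  have -> := deriveZ c (dt1 t x t0); rewrite -!derive1E e1//.
  have -> : laplacian (fun y => c * w t y) x = c * laplacian (w t) x.
    rewrite /laplacian mulr_sumr; apply: eq_bigr => i _.
    rewrite derive_dirZ => [|y]; [|exact: dx1].
    exact: deriveZ (dxx1 _ _ _ t0).
  by rewrite /GRing.scale/=; ring.
Qed.

Lemma heat0 nu2 : heat nu2 (fun _ _ => 0) (fun _ _ => 0).
Proof.
have D0 i : 'D_(e_ i) (fun=> 0) = (fun=> 0) :> ('rV[R]_d -> R).
  by apply/funext => y; exact: derive_cst.
split.
- by [].
- by move=> p; exact: cvg_cst.
- by move=> t x _; exact: derivable_cst.
- by move=> t x i _; exact: derivable_cst.
- by move=> t x i _; rewrite D0; exact: derivable_cst.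
- move=> t x _; rewrite derive1_cst /laplacian big1 ?mulr0 ?addr0// => i _.
  by rewrite D0; exact: derive_cst.
Qed.

Lemma heat_ext nu2 w1 w2 S1 S2 : (forall t x, w1 t x = w2 t x) ->
  (forall t x, S1 t x = S2 t x) -> heat nu2 w1 S1 -> heat nu2 w2 S2.
Proof.
move=> e1 e2; have -> : w1 = w2 by apply/funext => t; apply/funext => x.
by have -> : S1 = S2 by apply/funext => t; apply/funext => x.
Qed.

Lemma heat_sum nu2 (I : finType) (w S : I -> R -> 'rV[R]_d -> R) :
  (forall i, heat nu2 (w i) (S i)) ->
  heat nu2 (fun t x => \sum_i w i t x) (fun t x => \sum_i S i t x).
Proof.
move=> hw; apply: (@heat_ext _ (fun t x => \sum_(i <- enum I) w i t x) _ (fun t x => \sum_(i <- enum I) S i t x)) => [t x|t x|].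
- by rewrite big_enum.
- by rewrite big_enum.
elim: (enum I) => [|i s ih].
  by apply: heat_ext (heat0 nu2) => t x; rewrite big_nil.
by apply: heat_ext (heat_add (hw i) ih) => t x; rewrite big_cons.
Qed.

Lemma heat_unique nu2 w : 0 <= nu2 -> heat nu2 w (fun _ _ => 0) ->
  (forall x, w 0 x = 0) -> forall t x, 0 <= t -> w t x = 0.
Proof.
move=> nu0 hw w0.
have le0 v : heat nu2 v (fun _ _ => 0) -> (forall x, v 0 x = 0) ->
    forall t x, 0 <= t -> v t x <= 0.
  move=> [p c dt dx dxx e] v0 t x t0.
  apply: (@maximum_principle nu2 v t 0) => //.
  - by move=> s /andP[s0 _]; exact: p.
  - by move=> y; rewrite v0.
  - move=> s y /andP[s0 _] _; split; [exact: dt|by move=> i z; exact: dx|by move=> i; exact: dxx|].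
    by rewrite e// addr0.
  - by rewrite t0 lexx.
move=> t x t0; apply/eqP; rewrite eq_le le0//=.
have := le0 _ (heat_ext (fun _ _ => erefl) (fun _ _ => mulr0 (-1)) (heat_scale (-1) hw)).
by move=> /(_ _ t x t0); rewrite mulN1r oppr_le0; apply => y; rewrite w0 mulr0.
Qed.

End heat_equation.

(** * Measurability and continuity in time of Fourier coefficients *)

Section measurability.
Context {R : realType} {d : nat}.
Local Notation T := (d.-tuple (measurableTypeR R)).
Implicit Types (f : 'rV[R]_d -> R) (x : 'rV[R]_d).

Definition grid_box (a : R) (z : 'rV[int]_d) : set T :=
  [set y | forall j, (z 0 j)%:~R <= a * tnth y j < (z 0 j)%:~R + 1].

Lemma grid_box_measurable a z : measurable (grid_box a z).
Proof.
rewrite (_ : grid_box a z = \big[setI/setT]_(j < d) ((fun y : T => a * tnth y j) @^-1` `[(z 0 j)%:~R, (z 0 j)%:~R + 1[)); last first.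
  rewrite -bigcap_seq; apply/seteqP; split => y /= h.
    by move=> j _ /=; rewrite in_itv/=; exact: h.
  by move=> j; have := h j (mem_index_enum _); rewrite /= in_itv.
apply: bigsetI_measurable => j _.
rewrite -[X in measurable X]setTI; apply: (measurable_funM (measurable_cst a) (measurable_tnth j)) => //.
Qed.

(** Tuples carry the product sigma-algebra, while continuity refers to row vectors. The bridge is
    sampling: f at the corner of the grid cell of side 1 / (n + 1) takes countably many values on
    measurable cells and tends to f pointwise. *)
Lemma continuous_torus_measurable f : continuous f -> torus_measurable f.
Proof.
move=> cf.
pose r (n : nat) (y : T) : 'rV[R]_d := \row_j ((Num.floor (n.+1%:R * tnth y j))%:~R / n.+1%:R).
pose g (n : nat) (z : 'rV[int]_d) := f (\row_j ((z 0 j)%:~R / n.+1%:R)).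
apply: (@measurable_fun_cvg _ _ _ _ (fun n y => f (r n y))) => [n|y _].
  move=> _ A mA; rewrite setTI.
  rewrite (_ : _ @^-1` A = \bigcup_(z in [set: 'rV[int]_d]) (if g n z \in A then grid_box n.+1%:R z else set0)).
    apply: countable_bigcupT_measurable; first exact: countableP.
    by move=> z; case: ifP => _; [exact: grid_box_measurable|exact: measurable0].
  apply/seteqP; split => [y /= Ay|y [z _]].
    exists (\row_j Num.floor (n.+1%:R * tnth y j)) => //.
    rewrite ifT; last by rewrite inE /g; congr (A (f _)): Ay; apply/rowP => j; rewrite !mxE.
    by move=> j; rewrite mxE; have := real_floor_itv (num_real (n.+1%:R * tnth y j)); rewrite intrD1.
  case: ifPn => // /set_mem Az zy /=; rewrite /g in Az.
  congr (A (f _)) : Az; apply/rowP => j; rewrite !mxE; congr (_%:~R / _).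
  by apply/esym/floor_def; rewrite intrD1; exact: zy.
apply: (@continuous_cvg _ _ _ _ _ (r ^~ y) f); first exact: cf.
apply/cvg_ballP => e e0.
have [N hN] : exists N : nat, forall n, (N <= n)%N -> n.+1%:R^-1 < e :> R.
  exists (Num.truncn e^-1) => n Nn; rewrite invf_plt ?posrE//.
  by apply: (lt_le_trans (truncnS_gt _)); rewrite ler_nat.
exists N => // n /= /hN ne; split => // i j; rewrite ord1 !mxE /ball/=.
have := real_floor_itv (num_real (n.+1%:R * tnth y j)); rewrite intrD1.
set z := (Num.floor _)%:~R => /andP[h1 h2].
have n0 : 0 < n.+1%:R :> R by [].
have -> : tnth y j - z / n.+1%:R = (n.+1%:R * tnth y j - z) / n.+1%:R.
  by rewrite mulrBl mulrAC mulfV ?mul1r// gt_eqF.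
rewrite normrM ger0_norm ?subr_ge0// ger0_norm ?invr_ge0 ?ler0n//.
by apply: le_lt_trans ne; rewrite ler_piMl ?invr_ge0//; lra.
Qed.

End measurability.

Section time_continuity.
Context {R : realType} {d : nat}.
Local Notation mu := (@torus_measure R d).
Local Notation T := (d.-tuple (measurableTypeR R)).
Implicit Types (g : R -> 'rV[R]_d -> R) (x y : 'rV[R]_d) (t : R).

Lemma slice_continuous g t : continuous (fun p : R * 'rV[R]_d => g p.1 p.2) -> continuous (g t).
Proof.
move=> cg x U /(cg (t, x))[[A B] [/= hA hB] hAB].
by apply: filterS hB => y By; apply: (hAB (t, y)); split => //; exact: nbhs_singleton.
Qed.

Lemma periodic_uniform_in_time g t (e : R) : continuous (fun p : R * 'rV[R]_d => g p.1 p.2) ->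
  (forall s, torus_periodic (g s)) -> 0 < e ->
  \forall s \near t, forall x, `|g s x - g t x| < e.
Proof.
move=> cg pg e0.
have e20 : 0 < e / 2 by rewrite divr_gt0.
have /compact_near_coveringP nc := @unit_cube_compact R d.
have {nc} : \forall s \near t, @unit_cube R d `<=` (fun x => `|g s x - g t x| < e).
  apply: (nc R (nbhs t) (fun s x => `|g s x - g t x| < e)) => x _.
  have /cvgrPdist_lt /(_ _ e20)[[A B] [/= hA hB] hAB] := cg (t, x).
  exists (B, A) => //= -[y s] [/= By As].
  rewrite -(subrKA (g t x)) (le_lt_trans (ler_normD _ _))// [e]splitr.
  rewrite ltrD//; first by rewrite distrC; apply: (hAB (s, y)).
  by apply: (hAB (t, y)); split => //=; exact: nbhs_singleton.
apply: filterS => s hs x.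
have [y yc yE] := periodic_unit_cube x.
by rewrite !yE//; exact: hs.
Qed.

Lemma periodic_bounded (f : 'rV[R]_d -> R) : continuous f -> torus_periodic f ->
  exists2 M : R, 0 <= M & forall x : 'rV[R]_d, `|f x| <= M.
Proof.
move=> cf pf.
have cn : continuous (fun x : 'rV[R]_d => `|f x|) by move=> x; apply: (cvg_norm (cf x)).
have c0 : @unit_cube R d !=set0 by have [y yc _] := periodic_unit_cube (0 : 'rV[R]_d); exists y.
have [x _ xmax] := compact_EVT_max c0 (@unit_cube_compact R d) (continuous_subspaceT cn).
exists `|f x| => // y; have [z zc zE] := periodic_unit_cube y.
by rewrite zE//; apply: xmax; exact: mem_set.
Qed.

Lemma continuous_time_coef g (h : T -> R) : continuous (fun p : R * 'rV[R]_d => g p.1 p.2) ->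
  (forall s, torus_periodic (g s)) -> measurable_fun setT h -> (forall y : T, `|h y| <= 1) ->
  continuous (fun t => \int[mu]_y (g t (row_of y) * h y)).
Proof.
move=> cg pg mh bh t; apply/cvgrPdist_le => e e0.
have := periodic_uniform_in_time t cg pg e0; apply: filterS => s hs.
have ig r : mu.-integrable setT (EFin \o (fun y : T => g r (row_of y) * h y)).
  have cgr := @slice_continuous g r cg.
  have [M M0 hM] := periodic_bounded cgr (pg r).
  apply: (@ess_bounded_integrable _ _ (g r) M h 1) => //.
  by apply: bounded_ess_bounded => //; exact: continuous_torus_measurable.
rewrite -RintegralB//; apply: (le_trans (le_normr_Rintegral _ _)) => //.
  exact: (integrableB measurableT (ig t) (ig s)).
rewrite -[leRHS](Rintegral_setT_cst mu).
apply: le_Rintegral => //.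
- apply: integrable_norm; exact: (integrableB measurableT (ig t) (ig s)).
- by apply: (@integrable_bounded _ _ _ _ _ `|e|).
- move=> y _; rewrite -mulrBl normrM distrC (le_trans _ (ltW (hs (row_of y))))//.
  by rewrite ler_piMr.
Qed.

End time_continuity.

(** * Heat flow on one mode and Duhamel's formula *)

Section heat_modes.
Context {R : realType} {d : nat}.
Local Notation e_ i := (delta_mx 0 i : 'rV[R]_d).
Implicit Types (k : 'rV[int]_d) (x : 'rV[R]_d) (A B : R -> R).

Definition sqnorm k : R := \sum_i (k 0 i)%:~R ^+ 2.

Lemma dotZ_line k x i (r : R) : dotZ k (x + r *: e_ i) = dotZ k x + (k 0 i)%:~R * r.
Proof.
rewrite /dotZ (bigD1 i)//= [in RHS](bigD1 i)//= !mxE !eqxx mulr1.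
rewrite (eq_bigr (fun j => (k 0 j)%:~R * x 0 j)) => [|j ji]; first ring.
by rewrite !mxE (negbTE ji) andbF mulr0 addr0.
Qed.

Lemma is_derive_mode_cos k x i :
  is_derive x (e_ i) (mode_cos k) (- (2 * pi * (k 0 i)%:~R * mode_sin k x)).
Proof.
apply: is_derive_line.
have := is_derive_cos_affine (2 * pi * dotZ k x) (2 * pi * (k 0 i)%:~R) 0.
rewrite mulr0 addr0 (_ : (fun y => _) = fun r : R => mode_cos k (x + r *: e_ i))//.
by apply/funext => r; rewrite /mode_cos dotZ_line; congr cos; ring.
Qed.

Lemma is_derive_mode_sin k x i :
  is_derive x (e_ i) (mode_sin k) (2 * pi * (k 0 i)%:~R * mode_cos k x).
Proof.
apply: is_derive_line.
have := is_derive_sin_affine (2 * pi * dotZ k x) (2 * pi * (k 0 i)%:~R) 0.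
rewrite mulr0 addr0 (_ : (fun y => _) = fun r : R => mode_sin k (x + r *: e_ i))//.
by apply/funext => r; rewrite /mode_sin dotZ_line; congr sin; ring.
Qed.

Lemma is_derive_mode k x i (a b : R) : is_derive x (e_ i)
  (fun y => a * mode_cos k y + b * mode_sin k y)
  (2 * pi * (k 0 i)%:~R * b * mode_cos k x + (- (2 * pi * (k 0 i)%:~R * a)) * mode_sin k x).
Proof.
apply: is_derive_unique (is_derive_add (is_derive_scale a (is_derive_mode_cos k x i))
  (is_derive_scale b (is_derive_mode_sin k x i))) _.
ring.
Qed.

Lemma mode_periodic k (a b : R) : torus_periodic (fun y : 'rV[R]_d => a * mode_cos k y + b * mode_sin k y).
Proof.
have sp (c : R) (z : int) : sin (c + 2 * pi * z%:~R) = sin c.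
  by rewrite -!cosBpihalf addrAC cos_period_int.
move=> x i; rewrite /mode_cos /mode_sin.
have -> : dotZ k (x + e_ i) = dotZ k x + (k 0 i)%:~R.
  by rewrite -[e_ i]scale1r dotZ_line mulr1.
by rewrite mulrDr cos_period_int sp.
Qed.

Lemma continuous_dotZ k : continuous (fun x : 'rV[R]_d => dotZ k x).
Proof.
apply: (@continuous_big _ _ +%R 0) => [|i _ x]; first exact: add_continuous.
apply: (@cvgM R _ (nbhs x) _ (fun=> (k 0 i)%:~R) (fun y : 'rV[R]_d => y 0 i)); first exact: cvg_cst.
exact: coord_continuous.
Qed.

Lemma heat_mode (nu2 : R) k A B (dA dB : R -> R) :
  continuous (fun t : R => A (Num.max t 0)) -> continuous (fun t : R => B (Num.max t 0)) ->
  (forall t : R, 0 < t -> is_derive t 1 A (dA t - 4 * pi ^+ 2 * nu2 * sqnorm k * A t)) ->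
  (forall t : R, 0 < t -> is_derive t 1 B (dB t - 4 * pi ^+ 2 * nu2 * sqnorm k * B t)) ->
  heat nu2 (fun t x => A t * mode_cos k x + B t * mode_sin k x)
           (fun t x => dA t * mode_cos k x + dB t * mode_sin k x).
Proof.
move=> cA cB hA hB.
have D1 t i : 'D_(e_ i) (fun y => A t * mode_cos k y + B t * mode_sin k y) =
   (fun x => 2 * pi * (k 0 i)%:~R * B t * mode_cos k x + (- (2 * pi * (k 0 i)%:~R * A t)) * mode_sin k x).
  by apply/funext => x; have [_ ->] := is_derive_mode k x i (A t) (B t).
have cdot : continuous (fun p : R * 'rV[R]_d => 2 * pi * dotZ k p.2).
  move=> p; apply: cvgM; first exact: cvg_cst.
  by apply: (@continuous_cvg _ _ _ _ _ snd (dotZ k)); [exact: continuous_dotZ|exact: cvg_snd].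
have dt (t : R) x : 0 < t -> is_derive t 1 (fun r => A r * mode_cos k x + B r * mode_sin k x)
    (mode_cos k x * (dA t - 4 * pi ^+ 2 * nu2 * sqnorm k * A t) +
     mode_sin k x * (dB t - 4 * pi ^+ 2 * nu2 * sqnorm k * B t)).
  move=> t0; rewrite (_ : (fun r => _) = fun r => mode_cos k x * A r + mode_sin k x * B r); last first.
    by apply/funext => r; ring.
  by apply: is_derive_add; apply: is_derive_scale; [exact: hA|exact: hB].
split.
- by move=> t _; exact: mode_periodic.
- move=> p; apply: cvgD; apply: cvgM.
  + apply: (@continuous_cvg _ _ _ _ _ fst (fun t : R => A (Num.max t 0))); [exact: cA|exact: cvg_fst].
  + apply: (@continuous_cvg _ _ _ _ _ (fun p : R * 'rV[R]_d => 2 * pi * dotZ k p.2) cos); [exact: continuous_cos|exact: cdot].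
  + apply: (@continuous_cvg _ _ _ _ _ fst (fun t : R => B (Num.max t 0))); [exact: cB|exact: cvg_fst].
  + apply: (@continuous_cvg _ _ _ _ _ (fun p : R * 'rV[R]_d => 2 * pi * dotZ k p.2) sin); [exact: continuous_sin|exact: cdot].
- by move=> t x t0; have [] := dt t x t0.
- by move=> t x i _; have [] := is_derive_mode k x i (A t) (B t).
- move=> t x i _; rewrite D1.
  by have [] := is_derive_mode k x i (2 * pi * (k 0 i)%:~R * B t) (- (2 * pi * (k 0 i)%:~R * A t)).
- move=> t x t0; rewrite derive1E; have [_ ->] := dt t x t0.
  have -> : laplacian (fun y => A t * mode_cos k y + B t * mode_sin k y) x =
      - (4 * pi ^+ 2 * sqnorm k * (A t * mode_cos k x + B t * mode_sin k x)).
    rewrite /laplacian /sqnorm mulr_sumr mulr_suml -sumrN; apply: eq_bigr => i _.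
    rewrite D1.
    have [_ ->] := is_derive_mode k x i (2 * pi * (k 0 i)%:~R * B t) (- (2 * pi * (k 0 i)%:~R * A t)).
    ring.
  ring.
Qed.

(** Starting from -1 instead of 0 gives a two-sided derivative at time 0 as well. *)
Lemma duhamel_antiderivative (lam : R) (a : R -> R) : continuous a ->
  exists2 P : R -> R, P 0 = 0 & forall t : R, - 1 < t -> is_derive t 1 P (expR (lam * t) * a t).
Proof.
move=> ca.
have ce : continuous (fun t : R => expR (lam * t)).
  move=> t; have := is_derive_compose (is_derive_scale lam (is_derive_idf t)) (is_derive_expR (lam * t)).
  exact: is_derive_continuous.
have [|F hF] := @continuous_antiderivative R (fun t => expR (lam * t) * a t) (-1).
  by move=> t; apply: cvgM; [exact: ce|exact: ca].
exists (fun t => F t - F 0); first by rewrite subrr.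
move=> t t1; rewrite -[X in is_derive _ _ _ X]subr0.
by apply: is_derive_sub; exact: hF.
Qed.

Lemma is_derive_damped (lam c : R) (P : R -> R) (a t : R) : is_derive t 1 P (expR (lam * t) * a) ->
  is_derive t 1 (fun s => expR (- lam * s) * (c + P s)) (a - lam * (expR (- lam * t) * (c + P t))).
Proof.
move=> dP.
have dE := is_derive_compose (is_derive_scale (- lam) (is_derive_idf t)) (is_derive_expR (- lam * t)).
have dcP := is_derive_add (is_derive_const c t 1) dP.
apply: is_derive_unique (is_derive_mul dE dcP) _.
have : expR (- lam * t) * expR (lam * t) = 1 by rewrite -expRD mulNr addNr expR0.
set E := expR _; set E' := expR _ => EE.
have -> : E * (0 + E' * a) = (E * E') * a by ring.
rewrite EE; ring.
Qed.

Lemma continuous_max0 (P dP : R -> R) : (forall t : R, -1 < t -> is_derive t 1 P (dP t)) ->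
  continuous (fun t : R => P (Num.max t 0)).
Proof.
move=> hP t; apply: (@continuous_cvg _ _ _ _ _ (fun t : R => Num.max t 0) P).
  apply: is_derive_continuous (hP _ _); rewrite lt_max; apply/orP; right; lra.
apply: (@continuous_max R R (fun t : R => t) (fun=> 0)); [exact: cvg_id|exact: cvg_cst].
Qed.

End heat_modes.

Section duhamel_bound.
Context {R : realType} {d : nat}.
Local Notation mu := (@torus_measure R d).
Implicit Types (k : 'rV[int]_d) (x : 'rV[R]_d) (g : R -> 'rV[R]_d -> R).

Definition heat_rate (nu2 : R) k : R := 4 * pi ^+ 2 * nu2 * sqnorm k.

Definition gauss_weight (c : R) (i : nat) : R := expR (- (c * i%:R ^+ 2)).

Lemma gauss_weight_ge0 c i : 0 <= gauss_weight c i.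
Proof. exact: expR_ge0. Qed.

Lemma gauss_weight_decr c i j : 0 <= c -> (i <= j)%N -> gauss_weight c j <= gauss_weight c i.
Proof.
move=> c0 ij; rewrite ler_expR lerN2 ler_wpM2l// lerXn2r ?nnegrE// ler_nat //.
Qed.

(** The heat multiplier at time s factors over the coordinates, because |k|^2 is a sum; this makes
    the tensor product kernels applicable. *)
Lemma mode_weight_gauss (nu2 s : R) k :
  mode_weight (gauss_weight (4 * pi ^+ 2 * nu2 * s)) k = expR (- (heat_rate nu2 k * s)).
Proof.
rewrite /mode_weight /gauss_weight -expR_sum; congr expR.
rewrite sumrN -mulr_sumr /heat_rate /sqnorm -!mulrA; congr (- (_ * (_ * (_ * _)))).
rewrite [s * _]mulrC; congr (_ * (_ * _)); apply: eq_bigr => i _.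
by rewrite natr_absz intr_norm real_normK ?num_real.
Qed.

Record duhamel_family (nu2 : R) g (Pc Ps : 'rV[int]_d -> R -> R) : Prop := DuhamelFamily {
  dfam_c0 : forall k, Pc k 0 = 0;
  dfam_s0 : forall k, Ps k 0 = 0;
  dfam_c : forall k (t : R), -1 < t -> is_derive t 1 (Pc k)
     (expR (heat_rate nu2 k * t) * torus_int (fun y => g t y * mode_cos k y));
  dfam_s : forall k (t : R), -1 < t -> is_derive t 1 (Ps k)
     (expR (heat_rate nu2 k * t) * torus_int (fun y => g t y * mode_sin k y)) }.

(** The summand 0 is the vanishing initial coefficient; with it the expression is literally an
    instance of [heat_damped_mode]. *)
Definition duhamel_mode (nu2 : R) (Pc Ps : 'rV[int]_d -> R -> R) k (t : R) x : R :=
  expR (- heat_rate nu2 k * t) * (0 + Pc k t) * mode_cos k x +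
  expR (- heat_rate nu2 k * t) * (0 + Ps k t) * mode_sin k x.

Lemma duhamel_family_exists (nu2 : R) g : continuous (fun p : R * 'rV[R]_d => g p.1 p.2) ->
  (forall s, torus_periodic (g s)) -> exists Pc Ps, duhamel_family nu2 g Pc Ps.
Proof.
move=> cg pg.
have cc k : continuous (fun t => torus_int (fun y => g t y * mode_cos k y)).
  apply: (@continuous_time_coef R d g (fun y => mode_cos k (row_of y))) => //.
  - exact: measurable_mode_cos.
  - by move=> y; exact: cos_max.
have cs k : continuous (fun t => torus_int (fun y => g t y * mode_sin k y)).
  apply: (@continuous_time_coef R d g (fun y => mode_sin k (row_of y))) => //.
  - exact: measurable_mode_sin.
  - by move=> y; exact: sin_max.
have /choice[Pc hPc] : forall k, exists P : R -> R, P 0 = 0 /\ forall t : R, -1 < t -> is_derive t 1 P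
     (expR (heat_rate nu2 k * t) * torus_int (fun y => g t y * mode_cos k y)).
  by move=> k; have [P P0 hP] := duhamel_antiderivative (heat_rate nu2 k) (cc k); exists P.
have /choice[Ps hPs] : forall k, exists P : R -> R, P 0 = 0 /\ forall t : R, -1 < t -> is_derive t 1 P
     (expR (heat_rate nu2 k * t) * torus_int (fun y => g t y * mode_sin k y)).
  by move=> k; have [P P0 hP] := duhamel_antiderivative (heat_rate nu2 k) (cs k); exists P.
exists Pc, Ps; split => k.
- by have [] := hPc k.
- by have [] := hPs k.
- by have [_] := hPc k.
- by have [_] := hPs k.
Qed.

Lemma heat_damped_mode (nu2 : R) k (ac as_ : R -> R) (Pc Ps : R -> R) (a b : R) :
  (forall t : R, -1 < t -> is_derive t 1 Pc (expR (heat_rate nu2 k * t) * ac t)) ->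
  (forall t : R, -1 < t -> is_derive t 1 Ps (expR (heat_rate nu2 k * t) * as_ t)) ->
  heat nu2 (fun t x => expR (- heat_rate nu2 k * t) * (a + Pc t) * mode_cos k x +
                       expR (- heat_rate nu2 k * t) * (b + Ps t) * mode_sin k x)
           (fun t x => ac t * mode_cos k x + as_ t * mode_sin k x).
Proof.
move=> hc hs.
have dc (t : R) : -1 < t -> _ := fun t1 => is_derive_damped a (hc t t1).
have ds (t : R) : -1 < t -> _ := fun t1 => is_derive_damped b (hs t t1).
apply: (@heat_mode R d nu2 k (fun t => expR (- heat_rate nu2 k * t) * (a + Pc t))
  (fun t => expR (- heat_rate nu2 k * t) * (b + Ps t)) ac as_).
- exact: (continuous_max0 dc).
- exact: (continuous_max0 ds).
- by move=> t t0; apply: dc; apply: lt_trans t0.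
- by move=> t t0; apply: ds; apply: lt_trans t0.
Qed.

(** With t fixed, F(s) is the Duhamel integral cut off at time s. Its derivative is the band part of
    the heat multiplier at time t - s applied to g s, at most D exp(-e (t - s)), and this integrates
    to at most D / e. *)
Lemma duhamel_band_bound (nu2 : R) g Pc Ps n m (t M L : R) x : 0 < nu2 ->
  duhamel_family nu2 g Pc Ps -> (0 < n)%N -> (n <= m)%N -> 0 <= t -> 0 <= M ->
  (forall s, 0 <= s <= t -> ess_bounded (g s) M) ->
  1 <= L -> (forall j, (j <= m)%N -> l1le (dir j) L) ->
  `|\sum_(k \in modes m) duhamel_mode nu2 Pc Ps k t x -
    \sum_(k \in modes n) duhamel_mode nu2 Pc Ps k t x| <=
  M * (d%:R * L ^+ d * (2 * L)) / (4 * pi ^+ 2 * nu2 * n%:R ^+ 2).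
Proof.
move=> nu0 [c0 s0 hc hs] n0 nm t0 M0 gM L1 dirL.
pose Q (s : R) k := expR (- heat_rate nu2 k * t) * (mode_cos k x * Pc k s + mode_sin k x * Ps k s).
pose F (s : R) := \sum_(k \in modes m) Q s k - \sum_(k \in modes n) Q s k.
pose w (s : R) := gauss_weight (4 * pi ^+ 2 * nu2 * (t - s)).
pose f (s : R) := multiplier (w s) m (g s) x - multiplier (w s) n (g s) x.
have dQ k (s : R) : 0 <= s <= t -> is_derive s 1 (Q ^~ k) (mode_weight (w s) k * mode_part (g s) k x).
  move=> /andP[sa sb]; have s1 : -1 < s by lra.
  apply: is_derive_unique (is_derive_scale _ (is_derive_add (is_derive_scale _ (hc k s s1)) (is_derive_scale _ (hs k s s1)))) _.
  rewrite /w mode_weight_gauss /mode_part.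
  have -> : - (heat_rate nu2 k * (t - s)) = - heat_rate nu2 k * t + heat_rate nu2 k * s by ring.
  rewrite expRD; ring.
have dF (s : R) : 0 <= s <= t -> is_derive s 1 F (f s).
  move=> st; rewrite /F /f /multiplier !sum_modes.
  rewrite (_ : (fun s => _) = fun s => (\sum_(phi : @mode_box d m) Q s (box_mode phi)) - \sum_(phi : @mode_box d n) Q s (box_mode phi)); last first.
    by apply/funext => r; rewrite !sum_modes.
  by apply: is_derive_sub; apply: is_derive_sumf => phi; exact: dQ.
pose D := M * (d%:R * L ^+ d * (2 * L)).
have D0 : 0 <= D by rewrite !mulr_ge0// ?exprn_ge0//; lra.
pose e := 4 * pi ^+ 2 * nu2 * n%:R ^+ 2.
have pi0 := pi_gt0 R.
have c40 : 0 < 4 * pi ^+ 2 * nu2 by rewrite !mulr_gt0.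
have e0 : 0 < e by rewrite mulr_gt0// exprn_gt0// ltr0n.
have fb (s : R) : 0 <= s <= t -> `|f s| <= D * expR (- e * t + e * s).
  move=> /[dup] st /andP[sa sb].
  have cw : 0 <= 4 * pi ^+ 2 * nu2 * (t - s) by rewrite mulr_ge0 ?subr_ge0// ltW.
  have wd j : w s j.+1 <= w s j by exact: gauss_weight_decr.
  have wge j : 0 <= w s j by exact: gauss_weight_ge0.
  have w1 : w s 0%N = 1 by rewrite /w /gauss_weight expr0n/= mulr0 oppr0 expR0.
  have lk j : (j <= m)%N -> l1le (ker (w s) j) L.
    move=> jm; rewrite -[L]mul1r -w1; apply: ker_l1 => // i ij.
    by apply: dirL; exact: leq_trans jm.
  have lb := ker_band_l1 nm dirL wd wge.
  have := multiplier_band_bound x M0 (gM s st) L1 (lk n nm) (lk m (leqnn _)) lb.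
  move=> h; apply: (le_trans h).
  (* The band kernel gives the weight at n + 1, which monotonicity replaces by the weight at n. *)
  have -> : expR (- e * t + e * s) = w s n.
    by rewrite /w /gauss_weight /e; congr expR; ring.
  have -> : M * (d%:R * L ^+ d * (2 * w s n.+1 * L)) = D * w s n.+1 by rewrite /D; ring.
  by rewrite ler_wpM2l.
pose G (s : R) := D / e * expR (- e * t + e * s).
have dG (s : R) : 0 <= s <= t -> is_derive s 1 G (D * expR (- e * t + e * s)).
  move=> _; apply: is_derive_unique (is_derive_scale _ (is_derive_compose (is_derive_affine (- e * t) e s) (is_derive_expR _))) _.
  by rewrite mulrA divfK// gt_eqF.
have F0 : F 0 = 0.
  rewrite /F !sum_modes !big1 ?subrr// => phi _;
    by rewrite /Q c0 s0 !mulr0 addr0 mulr0.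
have GD : G t - G 0 <= D / e.
  rewrite /G mulNr addNr expR0 mulr1 gerBl mulr_ge0 ?expR_ge0//.
  by rewrite divr_ge0// ltW.
have h1 : F t - F 0 <= G t - G 0.
  by apply: (derive_le_increment t0 dF dG) => s st; rewrite (le_trans (ler_norm _))// fb.
have h2 : - F t - - F 0 <= G t - G 0.
  apply: (@derive_le_increment _ (fun s => - F s) G (fun s => - f s) (fun s => D * expR (- e * t + e * s))) => // s st.
    by apply: is_derive_opp; exact: dF.
  by rewrite (le_trans (ler_norm _))// normrN fb.
have -> : \sum_(k \in modes m) duhamel_mode nu2 Pc Ps k t x -
    \sum_(k \in modes n) duhamel_mode nu2 Pc Ps k t x = F t.
  by rewrite /F !sum_modes; congr (_ - _); apply: eq_bigr => phi _; rewrite /duhamel_mode /Q; ring.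
rewrite -/D -/e ler_norml; rewrite F0 in h1 h2; lra.
Qed.

End duhamel_bound.

(** * The Galerkin solution: splitting u = w + z and continuity argument *)

Section galerkin_solution.
Context {R : realType} {d : nat}.
Implicit Types (k : 'rV[int]_d) (x : 'rV[R]_d).

Lemma heat_source_ext (nu2 : R) (w : R -> 'rV[R]_d -> R) S1 S2 :
  (forall (t : R) x, 0 < t -> S1 t x = S2 t x) -> heat nu2 w S1 -> heat nu2 w S2.
Proof.
move=> S12 [p c dt dx dxx e]; split => // t x t0.
by rewrite e// S12.
Qed.

(** Continuity within the half-space t >= 0 is composed with the retraction (t, x) to (max(t, 0),
    x). *)
Lemma gac_continuous_max (nu : R) N (u0 : 'rV[R]_d -> R) (u : R -> 'rV[R]_d -> R) : galerkin_allen_cahn nu N u0 u ->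
  continuous (fun p : R * 'rV[R]_d => u (Num.max p.1 0) p.2).
Proof.
move=> [_ cu _ _ _ _] p.
pose A : set (R * 'rV[R]_d) := [set p | 0 <= p.1].
have mA (q : R * 'rV[R]_d) : A (Num.max q.1 0, q.2) by rewrite /A/= le_max lexx orbT.
have /subspace_continuousP/(_ _ (mA p)) cAp := cu.
have FF := nbhs_filter (p : (R * 'rV[R]_d)%type).
have cm : {for p, continuous (fun q : R * 'rV[R]_d => (Num.max q.1 0, q.2))}.
  have c1 : {for p, continuous (fun q : R * 'rV[R]_d => Num.max q.1 0)}.
    by apply: (@continuous_max R _ (fun q : R * 'rV[R]_d => q.1) (fun=> 0)); [exact: cvg_fst|exact: cvg_cst].
  have c2 : {for p, continuous (fun q : R * 'rV[R]_d => q.2)} by exact: cvg_snd.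
  move=> V [[V1 V2] /= [/c1 h1 /c2 h2] hV].
  apply: (@filterS _ (nbhs (p : (R * 'rV[R]_d)%type)) FF _ _ _ (@filterI _ _ FF _ _ h1 h2)) => q hq.
  exact: (hV (_, _)).
move=> U /cAp hU; have := cm _ hU.
by apply: (@filterS _ (nbhs (p : (R * 'rV[R]_d)%type)) FF) => q /=; apply; exact: mA.
Qed.

Definition cubic (v : R) : R := v ^+ 3 - v.

Lemma trig_poly_cubic n (v : 'rV[R]_d -> R) : trig_poly n v -> trig_poly (3 * n) (fun x => cubic (v x)).
Proof.
move=> hv; apply: (@trig_poly_ext _ _ _ (fun x => v x * (v x * v x) + - v x)) => [x|].
  by rewrite /cubic -expr2 -exprS.
apply: trig_poly_add.
  rewrite (_ : (3 * n)%N = (n + (n + n))%N); last lia.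
  by apply: trig_poly_mul => //; exact: trig_poly_mul.
by apply: trig_poly_opp; apply: trig_poly_widen hv; lia.
Qed.

Section fixed_solution.
Context (nu : R) (N : nat) (u0 : 'rV[R]_d -> R) (u : R -> 'rV[R]_d -> R) (B0 : R).
Hypothesis nu_gt0 : 0 < nu.
Hypothesis B0_ge0 : 0 <= B0.
Hypothesis u0_bounded : ess_bounded u0 B0.
Hypothesis sol : galerkin_allen_cahn nu N u0 u.

Let nu2 : R := nu ^+ 2.
Let nu2_gt0 : 0 < nu2. Proof. exact: exprn_gt0. Qed.

Let g (t : R) x : R := cubic (u (Num.max t 0) x).

Let g_continuous : continuous (fun p : R * 'rV[R]_d => g p.1 p.2).
Proof.
have cu := gac_continuous_max sol; move=> p.
have c3 : continuous cubic.
  move=> v; apply: cvgB; last exact: cvg_id.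
  exact: exprn_continuous.
exact: (@continuous_cvg _ _ _ _ _ _ cubic (u (Num.max p.1 0) p.2) (c3 _) (cu p)).
Qed.

Let g_periodic (t : R) : torus_periodic (g t).
Proof. by move=> x i; rewrite /g (gac_periodic sol)// le_max lexx orbT. Qed.

Let g_ess_bounded (t : R) : exists2 M : R, 0 <= M & ess_bounded (g t) M.
Proof.
have cg := @slice_continuous _ _ g t g_continuous.
have [M M0 hM] := periodic_bounded cg (g_periodic t); exists M => //.
by apply: bounded_ess_bounded => //; exact: continuous_torus_measurable.
Qed.

Let gE (t : R) : 0 <= t -> g t = fun x => cubic (u t x).
Proof. by move=> t0; apply/funext => x; rewrite /g (max_idPl t0). Qed.

Let heat_u : heat nu2 u (fun t x => - fproj N (g t) x).
Proof.
split.
- exact: (gac_periodic sol).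
- exact: (gac_continuous_max sol).
- by move=> t x t0; exact: (gac_derivable_t sol).
- by move=> t x i t0; exact: (gac_derivable_x sol x i t0).1.
- by move=> t x i t0; exact: (gac_derivable_x sol x i t0).2.
- by move=> t x t0; rewrite (gac_equation sol x t0) (gE (ltW t0)).
Qed.

Section with_duhamel.
Variables (Pc Ps : 'rV[int]_d -> R -> R).
Hypothesis fam : duhamel_family nu2 g Pc Ps.

Let Z := duhamel_mode nu2 Pc Ps.

Let Z_sum n (t : R) x := \sum_(k \in modes n) Z k t x.

Let heat_Z n : heat nu2 (Z_sum n) (fun t x => \sum_(k \in modes n) mode_part (g t) k x).
Proof.
apply: (@heat_ext _ _ nu2 (fun t x => \sum_(phi : @mode_box d n) Z (box_mode phi) t x) _
  (fun t x => \sum_(phi : @mode_box d n) mode_part (g t) (box_mode phi) x)).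
- by move=> t x; rewrite /Z_sum sum_modes.
- by move=> t x; rewrite sum_modes.
apply: heat_sum => phi.
exact: (heat_damped_mode 0 0 (dfam_c fam (box_mode phi)) (dfam_s fam (box_mode phi))).
Qed.

Let Z_sum0 n x : Z_sum n 0 x = 0.
Proof.
rewrite /Z_sum sum_modes big1// => phi _.
by rewrite /Z /duhamel_mode (dfam_c0 fam) (dfam_s0 fam) addr0 !mulr0 !mul0r addr0.
Qed.

Let Z_trig n (t : R) : trig_poly n (Z_sum n t).
Proof.
apply: (@trig_poly_ext _ _ _ (fun x => \sum_(phi : @mode_box d n) Z (box_mode phi) t x)) => [x|].
  by rewrite /Z_sum sum_modes.
apply: trig_poly_sum => phi; have hm : modes n (box_mode phi) by apply/modesE; exists phi.
apply: trig_poly_add; apply: trig_poly_scale.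
- by rewrite mode_cos_wave; exact: trig_poly_wave.
- by rewrite mode_sin_wave; exact: trig_poly_wave.
Qed.

(* u agrees with its Duhamel representation, which is a trigonometric polynomial. *)
Let u_trig (t : R) : 0 <= t -> trig_poly N (u t).
Proof.
pose a k := torus_int (fun y => u0 y * mode_cos k y).
pose b k := torus_int (fun y => u0 y * mode_sin k y).
pose H k (t : R) x := expR (- heat_rate nu2 k * t) * (a k + 0) * mode_cos k x +
  expR (- heat_rate nu2 k * t) * (b k + 0) * mode_sin k x.
have heat_H k : heat nu2 (H k) (fun _ _ => 0).
  have z0 (s : R) : -1 < s -> is_derive s 1 (fun=> 0) (expR (heat_rate nu2 k * s) * 0).
    by move=> _; rewrite mulr0; exact: is_derive_const.
  apply: heat_ext (heat_damped_mode (a k) (b k) z0 z0) => // s x.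
  by rewrite !mul0r addr0.
pose w (t : R) x := u t x + (Z_sum N t x + (-1) * \sum_(phi : @mode_box d N) H (box_mode phi) t x).
have heat_w : heat nu2 w (fun _ _ => 0).
  apply: heat_source_ext (heat_add heat_u (heat_add (heat_Z N) (heat_scale (-1) (heat_sum (fun phi : @mode_box d N => heat_H (box_mode phi)))))) => s x s0 /=.
  have [M M0 gM] := g_ess_bounded s.
  by rewrite (fproj_mode_part _ _ M0 gM) [X in -1 * X]big1// mulr0 addr0 addNr.
have w0 x : w 0 x = 0.
  rewrite /w Z_sum0 add0r (gac_initial sol) (fproj_mode_part _ _ B0_ge0 u0_bounded) sum_modes.
  rewrite mulN1r -sumrB big1// => phi _.
  by rewrite /H mulr0 expR0 !mul1r !addr0 subrr.
move=> t0.
apply: (@trig_poly_ext _ _ _ (fun x => - Z_sum N t x + \sum_(phi : @mode_box d N) H (box_mode phi) t x)) => [x|].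
  by have := heat_unique (ltW nu2_gt0) heat_w w0 x t0; rewrite /w mulN1r; lra.
apply: trig_poly_add; first by apply: trig_poly_opp; exact: Z_trig.
apply: trig_poly_sum => phi; have hm : modes N (box_mode phi) by apply/modesE; exists phi.
apply: trig_poly_add; apply: trig_poly_scale.
- by rewrite mode_cos_wave; exact: trig_poly_wave.
- by rewrite mode_sin_wave; exact: trig_poly_wave.
Qed.

Let z (t : R) x := Z_sum (3 * N) t x + (-1) * Z_sum N t x.
Let w (t : R) x := u t x + (-1) * z t x.

(** The sources add up to -Pi_N g - (Pi_3N g - Pi_N g) = -Pi_3N g, and Pi_3N g = g because g has
    degree at most 3N. *)
Let heat_w : heat nu2 w (fun t x => - g t x).
Proof.
apply: heat_source_ext (heat_add heat_u (heat_scale (-1) (heat_add (heat_Z (3 * N)) (heat_scale (-1) (heat_Z N))))) => t x t0 /=.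
have [M M0 gM] := g_ess_bounded t.
rewrite (fproj_mode_part _ _ M0 gM).
have gt : trig_poly (3 * N) (g t) by rewrite gE ?ltW//; apply: trig_poly_cubic; exact: u_trig (ltW t0).
rewrite (trig_poly_mode_part gt x).1; ring.
Qed.

Lemma u_bound_step (T M0 e : R) : 1 <= M0 -> (forall x, `|fproj N u0 x| <= M0) -> 0 <= e ->
  (forall t x, 0 <= t <= T -> `|z t x| <= e) ->
  forall t x, 0 <= t <= T -> `|u t x| <= M0 + 2 * e.
Proof.
move=> M01 hM0 e0 hz.
have wz t x : u t x = w t x + z t x by rewrite /w mulN1r subrK.
have w0 x : `|w 0 x| <= M0 + e.
  by rewrite /w /z !Z_sum0 mulr0 addr0 mulr0 addr0 (gac_initial sol) (le_trans (hM0 x))// lerDl.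
(* The margin e in the threshold absorbs z: where w > M0 + e, u = w + z is above M0 >= 1, so the
   source -f(u) is at most 0. *)
have up t x : 0 <= t <= T -> w t x <= M0 + e.
  apply: (@maximum_principle _ _ nu2 w T (M0 + e)) => //.
  - exact: ltW.
  - by move=> s /andP[s0 _]; exact: (heat_periodic heat_w).
  - exact: (heat_continuous heat_w).
  - by move=> y; exact: le_trans (ler_norm _) (w0 y).
  - move=> s y /andP[s0 sT] wm; split.
    + exact: (heat_dt heat_w).
    + by move=> i v; exact: (heat_dx heat_w).
    + by move=> i; exact: (heat_dxx heat_w).
    + rewrite (heat_eq heat_w)// gerDl oppr_le0 gE ?(ltW s0)//.
      have : - e <= z s y by have := hz s y; rewrite (ltW s0) sT => /(_ isT); rewrite ler_norml => /andP[].
      move: wm (wz s y) => /=; rewrite /cubic; set v := u s y => wm vE zl.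
      have v1 : 1 <= v by lra.
      have -> : v ^+ 3 - v = v * ((v - 1) * (v + 1)) by ring.
      by rewrite !mulr_ge0//; lra.
have heat_nw := heat_scale (-1) heat_w.
have lo t x : 0 <= t <= T -> -1 * w t x <= M0 + e.
  apply: (@maximum_principle _ _ nu2 (fun t x => -1 * w t x) T (M0 + e)) => //.
  - exact: ltW.
  - by move=> s /andP[s0 _]; exact: (heat_periodic heat_nw).
  - exact: (heat_continuous heat_nw).
  - by move=> y; rewrite mulN1r; apply: le_trans (w0 y); rewrite -normrN ler_norm.
  - move=> s y /andP[s0 sT] wm; split.
    + exact: (heat_dt heat_nw).
    + by move=> i v; exact: (heat_dx heat_nw).
    + by move=> i; exact: (heat_dxx heat_nw).
    + rewrite (heat_eq heat_nw)// gerDl mulrNN mul1r gE ?(ltW s0)//.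
      have : z s y <= e by have := hz s y; rewrite (ltW s0) sT => /(_ isT); rewrite ler_norml => /andP[].
      move: wm (wz s y) => /=; rewrite /cubic; set v := u s y => wm vE zl.
      have v1 : v <= -1 by lra.
      have -> : v ^+ 3 - v = - ((- v) * ((- v - 1) * (- v + 1))) by ring.
      by rewrite oppr_le0 !mulr_ge0//; lra.
move=> t x tT; rewrite wz ler_norml.
have := up t x tT; have := lo t x tT; have := hz t x tT; rewrite ler_norml => /andP[z1 z2]; lra.
Qed.

Lemma z_bound (T K L : R) : (0 < N)%N -> 0 <= K -> 1 <= L ->
  (forall j, (j <= 3 * N)%N -> l1le (dir j) L) ->
  (forall t x, 0 <= t <= T -> `|u t x| <= K) ->
  forall t x, 0 <= t <= T -> `|z t x| <=
   (K ^+ 3 + K) * (d%:R * L ^+ d * (2 * L)) / (4 * pi ^+ 2 * nu2 * N%:R ^+ 2).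
Proof.
move=> N0 K0 L1 hL uK t x /andP[t0 tT].
have := @duhamel_band_bound R d nu2 g Pc Ps N (3 * N) t (K ^+ 3 + K) L x nu2_gt0 fam N0.
rewrite /z mulN1r; apply => //; [by rewrite leq_pmull|by rewrite addr_ge0// exprn_ge0|].
move=> s /andP[s0 st]; apply: bounded_ess_bounded.
  by apply: continuous_torus_measurable; exact: slice_continuous g_continuous.
move=> y; rewrite gE// /cubic.
have uy : `|u s y| <= K by apply: uK; rewrite s0 (le_trans st).
rewrite (le_trans (ler_normB _ _))// lerD// normrX lerXn2r ?nnegrE//.
Qed.

Lemma bootstrap (M0 L : R) : (0 < N)%N -> 1 <= M0 -> (forall x, `|fproj N u0 x| <= M0) ->
  1 <= L -> (forall j, (j <= 3 * N)%N -> l1le (dir j) L) ->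
  let e := ((M0 + 1) ^+ 3 + (M0 + 1)) * (d%:R * L ^+ d * (2 * L)) / (4 * pi ^+ 2 * nu2 * N%:R ^+ 2) in
  2 * e < 1 -> forall t x, 0 <= t -> `|u t x| <= M0 + 2 * e.
Proof.
move=> N0 M01 hM0 L1 hL e e1.
have e0 : 0 <= e.
  rewrite /e; apply: divr_ge0.
    by rewrite !mulr_ge0 ?addr_ge0 ?exprn_ge0//; lra.
  by rewrite mulr_ge0 ?exprn_ge0 ?ler0n// mulr_ge0 ?(ltW nu2_gt0)// mulr_ge0 ?sqr_ge0.
pose K := M0 + 1.
(* The a priori bound K = M0 + 1 improves itself to M0 + 2e, which is strictly smaller since 2e <
   1. *)
have step (T : R) : (forall t x, 0 <= t <= T -> `|u t x| <= K) ->
    forall t x, 0 <= t <= T -> `|u t x| <= M0 + 2 * e.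
  move=> hK; apply: u_bound_step => //; apply: z_bound => //; rewrite /K; lra.
pose S : set R := [set T | 0 <= T /\ forall t x, 0 <= t <= T -> `|u t x| <= K].
have S0 : S 0.
  split => // t x /le_anti <-; rewrite (gac_initial sol) (le_trans (hM0 x))//; rewrite /K; lra.
(* A violation at t1 keeps S below t1, so S has a supremum T; it will be contradicted by a larger
   element of S. *)
move=> t1 x1 t10; rewrite leNgt; apply/negP => big.
have Sub T : S T -> T < t1.
  move=> [T0 hT]; rewrite ltNge; apply/negP => tT.
  by move: big; rewrite ltNge (step T)// t10.
have hs : has_sup S by split; [exists 0|exists t1 => T /Sub /ltW].
pose T := sup S.
have T0 : 0 <= T by apply: ub_le_sup => //; exact: hs.2.
have near (c : R) : 0 < c -> exists2 de : R, 0 < de & forall s x, `|T - s| < de -> `|u (Num.max s 0) x - u T x| < c.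
  move=> c0; have per (s : R) : torus_periodic (fun x => u (Num.max s 0) x).
    by move=> y i; rewrite (gac_periodic sol)// le_max lexx orbT.
  have := @periodic_uniform_in_time R d (fun t x => u (Num.max t 0) x) T c (gac_continuous_max sol) per c0.
  move=> /nbhs_ballP[de /= de0 hde]; exists de => // s x sT.
  by have := hde s sT x; rewrite [in X in _ - u X _](max_idPl T0).
have below t x : 0 <= t -> t < T -> `|u t x| <= K.
  move=> t0 tT; have [s [s0 hss] ts] := sup_gt (proj1 hs) tT.
  by apply: hss; rewrite t0 ltW.
(* Passing to the limit from the left needs earlier times, hence the separate case T = 0. *)
have atT x : `|u T x| <= K.
  have [T00|Tp] := eqVneq T 0; first by rewrite T00; apply: S0.2; rewrite lexx.
  have {}Tp : 0 < T by rewrite lt_neqAle eq_sym Tp.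
  apply/ler_addgt0Pr => c c0; have [de de0 hde] := near c c0.
  pose s := Num.max (T - de / 2) 0.
  have s0 : 0 <= s by rewrite le_max lexx orbT.
  have sT : s < T by rewrite gt_max Tp andbT gtrDl oppr_lt0 divr_gt0.
  have sd : `|T - s| < de.
    rewrite gtr0_norm ?subr_gt0//; have : T - de / 2 <= s by rewrite le_max lexx.
    lra.
  have := hde s x sd; rewrite (max_idPl s0) distrC => h.
  rewrite -[u T x](subrK (u s x)) addrC (le_trans (ler_normD _ _))// lerD ?(ltW h)//.
  exact: below.
have ST : forall t x, 0 <= t <= T -> `|u t x| <= K.
  move=> t x /andP[t0]; rewrite le_eqVlt => /predU1P[->|]; [exact: atT|exact: below].
(* At time T the improved bound leaves room 1 - 2e below K. Continuity in time, uniform in x, keeps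
   |u| <= K up to T + de / 2. *)
have gap : 0 < 1 - 2 * e by lra.
have [de de0 hde] := near _ gap.
have : S (T + de / 2).
  split => [|t x /andP[t0 tT]]; first by rewrite addr_ge0// divr_ge0// ltW.
  have [tT'|Tt] := leP t T; first by apply: ST; rewrite t0.
  have := hde t x; rewrite (max_idPl t0) => /(_ _) h.
  have {}h : `|u t x - u T x| < 1 - 2 * e.
    by apply: h; rewrite distrC gtr0_norm ?subr_gt0//; lra.
  have := step T ST T x; rewrite T0 lexx => /(_ isT) uT.
  rewrite -[u t x](subrK (u T x)) (le_trans (ler_normD _ _))// /K; lra.
move=> ST'; have := ub_le_sup hs.2 ST'; rewrite -/T.
by have : 0 < de / 2 by [rewrite divr_gt0|]; lra.
Qed.

End with_duhamel.

Lemma gac_bound_of_small_error (M0 L : R) : (0 < N)%N -> 1 <= M0 -> (forall x, `|fproj N u0 x| <= M0) ->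
  1 <= L -> (forall j, (j <= 3 * N)%N -> l1le (dir j) L) ->
  let e := ((M0 + 1) ^+ 3 + (M0 + 1)) * (d%:R * L ^+ d * (2 * L)) / (4 * pi ^+ 2 * nu ^+ 2 * N%:R ^+ 2) in
  2 * e < 1 -> forall t x, 0 <= t -> `|u t x| <= M0 + 2 * e.
Proof.
have [Pc [Ps fam]] := duhamel_family_exists nu2 g_continuous g_periodic.
exact: (bootstrap fam).
Qed.

End fixed_solution.
End galerkin_solution.

(** * Size of the error *)

Section error_size.
Context {R : realType}.

Lemma ln_le_powR (a y : R) : 0 < a -> 1 <= y -> ln y <= y `^ a / a.
Proof.
move=> a0 y1; have y0 : 0 < y by rewrite (lt_le_trans ltr01).
rewrite ler_pdivlMr// mulrC -ln_powR ltW// ln_sublinear// powR_gt0 //.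
Qed.

(** With a = 1 / (8d), ln y <= y^a / a gives L <= (1 + 256 d) N^a. Here 256 = 4 * 8 * 8: the factor
    4 in L, the bound (8N)^a <= 8 N^a, and 1 / a = 8d. Raising to the power 8d >= 4d + 1 turns N^a
    into N. *)
Lemma dirichlet_bound_growth (d N : nat) : (0 < d)%N -> (0 < N)%N ->
  (1 + 4 * ln (2 + 6 * N%:R)) ^+ (4 * d).+1 <= (1 + 256 * d%:R) ^+ (8 * d) * N%:R :> R.
Proof.
move=> d0 N0; set L := 1 + _.
pose a : R := ((8 * d)%N%:R)^-1.
have d1 : (1 : R) <= d%:R by rewrite ler1n.
have N1 : (1 : R) <= N%:R by rewrite ler1n.
have a0 : 0 < a by rewrite invr_gt0 ltr0n; lia.
have a1 : a <= 1 by rewrite invf_le1 ?ler1n ?ltr0n; lia.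
have r1 : 1 <= N%:R `^ a by rewrite -[X in X <= _](powRr0 (N%:R : R)); apply: ler_powR => //; exact: ltW.
have L1 : 1 <= L by rewrite /L lerDl mulr_ge0// ln_ge0//; lra.
have LA : L <= (1 + 256 * d%:R) * N%:R `^ a.
  have h1 : ln (2 + 6 * N%:R) <= ln (8 * N%:R) :> R by rewrite ler_ln ?posrE; lra.
  have h2 : ln (8 * N%:R) <= (8 * N%:R) `^ a / a :> R by apply: ln_le_powR => //; lra.
  have h3 : (8 * N%:R) `^ a <= 8 * N%:R `^ a.
    rewrite powRM// ?ler0n// ler_wpM2r ?powR_ge0//.
    by apply: ler1_powR => //; lra.
  have h4 : (8 * N%:R) `^ a / a <= 64 * (d%:R * N%:R `^ a).
    have av : a^-1 = 8 * d%:R by rewrite invrK natrM.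
    have a'0 : 0 <= a^-1 by rewrite invr_ge0 ltW.
    apply: le_trans (ler_wpM2r a'0 h3) _.
    by rewrite av (_ : 8 * N%:R `^ a * (8 * d%:R) = 64 * (d%:R * N%:R `^ a))//; ring.
  have -> : (1 + 256 * d%:R) * N%:R `^ a = N%:R `^ a + 256 * (d%:R * N%:R `^ a) by ring.
  rewrite /L; lra.
apply: (@le_trans _ _ (L ^+ (8 * d))).
  by apply: ler_weXn2l => //; lia.
have -> : (N%:R : R) = (N%:R `^ a) ^+ (8 * d).
  by rewrite -powR_mulrn ?powR_ge0// -powRrM mulVf ?powRr1 ?ler0n// pnatr_eq0; lia.
by rewrite -exprMn; apply: lerXn2r => //; rewrite nnegrE; lra.
Qed.

(** With Y = L^d, both (M0 + 1)^3 and M0 + 1 are at most 8 Y^3, so the numerator is at most 32 d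
    L^(4d + 1), which costs one factor N. *)
Lemma error_decay (d N : nat) (c E M0 L : R) : 0 < c -> (0 < N)%N -> 1 <= L ->
  L ^+ (4 * d).+1 <= E * N%:R -> 1 <= M0 -> M0 <= L ^+ d ->
  ((M0 + 1) ^+ 3 + (M0 + 1)) * (d%:R * L ^+ d * (2 * L)) / (c * N%:R ^+ 2) <=
  32 * d%:R * E / c / N%:R.
Proof.
move=> c0 N0 L1 LE M1 ML.
have N1 : (0 : R) < N%:R by rewrite ltr0n.
set Y := L ^+ d in ML *.
have Y1 : 1 <= Y by lra.
have h1 : (M0 + 1) ^+ 3 <= (2 * Y) ^+ 3 by rewrite lerXn2r ?nnegrE; lra.
have h2 : M0 + 1 <= 8 * Y ^+ 3.
  have : Y <= Y ^+ 3 by rewrite -[X in X <= _]expr1; apply: ler_weXn2l.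
  lra.
have h3 : (M0 + 1) ^+ 3 + (M0 + 1) <= 16 * Y ^+ 3.
  rewrite exprMn in h1; lra.
have Z0 : 0 <= d%:R * Y * (2 * L) by rewrite !mulr_ge0 ?ler0n//; lra.
have h4 : ((M0 + 1) ^+ 3 + (M0 + 1)) * (d%:R * Y * (2 * L)) <= 32 * d%:R * (E * N%:R).
  apply: le_trans (ler_wpM2r Z0 h3) _.
  have -> : 16 * Y ^+ 3 * (d%:R * Y * (2 * L)) = 32 * d%:R * L ^+ (4 * d).+1.
    have -> : L ^+ (4 * d).+1 = L * Y ^+ 4 by rewrite exprS (mulnC 4) exprM.
    ring.
  by rewrite ler_wpM2l// mulr_ge0.
have -> : 32 * d%:R * E / c / N%:R = 32 * d%:R * (E * N%:R) / (c * N%:R ^+ 2).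
  by field; rewrite !gt_eqF.
by rewrite ler_wpM2r// invr_ge0 mulr_ge0 ?exprn_ge0 ?ltW.
Qed.

End error_size.

(** * The effective bound and the two statements *)

Section effective_bound.
Context {R : realType} {d : nat}.
Implicit Types (f : 'rV[R]_d -> R) (u : R -> 'rV[R]_d -> R).

Lemma fproj_dirichlet_bound N f (M B : R) x : 0 <= M -> ess_bounded f M ->
  l1le (dir N) B -> `|fproj N f x| <= M * B ^+ d.
Proof.
move=> M0 hf hB; have := multiplier_bound x M0 hf hB; congr (`|_| <= _).
rewrite (fproj_mode_part _ _ M0 hf) /multiplier; apply: eq_fsbigr => k _.
by rewrite /mode_weight big1 ?mul1r.
Qed.

Lemma gac_effective_bound (nu : R) : (0 < d)%N -> 0 < nu ->
  exists2 E : R, 0 <= E & forall N f u (M : R), (0 < N)%N -> E < N%:R ->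
    ess_bounded f 1 -> galerkin_allen_cahn nu N f u ->
    (forall x, `|fproj N f x| <= M) ->
    forall t x, 0 <= t -> `|u t x| <= Num.max M 1 + E / N%:R.
Proof.
move=> d0 nu0.
pose c : R := 4 * pi ^+ 2 * nu ^+ 2.
have c0 : 0 < c by rewrite !mulr_gt0 ?exprn_gt0 ?pi_gt0.
pose A : R := (1 + 256 * d%:R) ^+ (8 * d).
have A0 : 0 <= A by apply: exprn_ge0; apply: addr_ge0; [exact: ler01|apply: mulr_ge0; exact: ler0n].
pose E := 32 * d%:R * A / c.
have E0 : 0 <= E by rewrite divr_ge0 ?(ltW c0)// !mulr_ge0.
exists (2 * E) => [|N f u M N0 EN f1 sol hM t x t0]; first by rewrite mulr_ge0.
(* The bound of [dir_l1] at the largest degree 3N; the added 1 ensures 1 <= L. *)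
pose L : R := 1 + 4 * ln (2 + 6 * N%:R).
have N1 : (1 : R) <= N%:R by rewrite ler1n.
have L1 : 1 <= L by rewrite /L lerDl mulr_ge0// ln_ge0//; lra.
have dirL j : (j <= 3 * N)%N -> l1le (@dir R j) L.
  move=> jN; apply: l1le_weaken (dir_l1 j).
  have jR : j%:R <= 3 * N%:R :> R by rewrite -natrM ler_nat.
  have j0 : 0 <= j%:R :> R by [].
  have : ln (2 + 2 * j%:R) <= ln (2 + 6 * N%:R) :> R by rewrite ler_ln ?posrE; lra.
  rewrite /L; lra.
(* Both entries bound Pi_N u_0. The first one appears in the conclusion; the second one keeps the
   error polylogarithmic before division by N^2, with a constant independent of M. *)
pose M0 := Num.min (Num.max M 1) (L ^+ d).
have M01 : 1 <= M0 by rewrite le_min le_max lexx orbT/= exprn_ege1.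
have hM0 y : `|fproj N f y| <= M0.
  rewrite le_min le_max hM/= -[L ^+ d]mul1r.
  by apply: fproj_dirichlet_bound => //; apply: dirL; rewrite leq_pmull.
have M0L : M0 <= L ^+ d by rewrite ge_min lexx orbT.
have M0M : M0 <= Num.max M 1 by rewrite ge_min lexx.
have LA : L ^+ (4 * d).+1 <= A * N%:R by exact: dirichlet_bound_growth.
have eE := error_decay c0 N0 L1 LA M01 M0L.
(* The threshold on N serves only to meet the smallness condition of the continuity argument. *)
have EN1 : 2 * (E / N%:R) < 1 by rewrite mulrA ltr_pdivrMr ?mul1r// ltr0n.
have := gac_bound_of_small_error nu0 ler01 f1 sol N0 M01 hM0 L1 dirL.
rewrite -/c /= -/E in eE *; move: eE.
set e := _ / (c * _) => eE /(_ _) h.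
have {}h : 2 * e < 1 -> `|u t x| <= M0 + 2 * e by move=> e1; exact: h.
have := h ltac:(lra); rewrite -[2 * E / _]mulrA; lra.
Qed.

Lemma Linfty_norm_le_ae f (M : R) : (Linfty_norm f <= M%:E)%E ->
  {ae @torus_measure R d, forall y, `|f (row_of y)| <= M}.
Proof.
rewrite /Linfty_norm unlock /= probability_setT lte01 => /ess_supP.
by apply: filterS => y /=; rewrite lee_fin.
Qed.

Lemma Linfty_norm_le f (M : R) : (forall x, `|f x| <= M) -> (Linfty_norm f <= M%:E)%E.
Proof.
move=> fM; rewrite /Linfty_norm unlock /= probability_setT lte01.
by apply/ess_supP; apply: nearW => y /=; rewrite lee_fin.
Qed.

Lemma sup_Linfty_norm_le u (M : R) : (forall t x, 0 <= t -> `|u t x| <= M) ->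
  (ereal_sup [set Linfty_norm (u t) | t in [set t : R | (0 <= t)%R]] <= M%:E)%E.
Proof.
move=> uM; apply: ge_ereal_sup => _ [t t0 <-].
by apply: Linfty_norm_le => x; exact: uM.
Qed.

End effective_bound.

Unset Implicit Arguments.

Theorem theorem1p5 (R : realType) (d : nat) (nu : R) (u0 : 'rV[R]_d -> R)
    (hd : (0 < d)%N) (hnu : 0 < nu)
    (u0_per : torus_periodic u0) (u0_meas : torus_measurable u0) :
  ((Linfty_norm u0 <= 1%:E)%E ->
   forall s : R, d%:R / 2 < s -> (Hs_sqnorm s u0 < +oo)%E ->
   exists (N0 : nat) (C1 : R), 0 < C1 /\
     forall N : nat, (N0 <= N)%N ->
     forall u : R -> 'rV[R]_d -> R, galerkin_allen_cahn nu N u0 u ->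
     (ereal_sup [set Linfty_norm (u t) | t in [set t : R | (0 <= t)%R]]
       <= (1 + N%:R `^ (- Num.min (s - d%:R / 2) 1) * C1)%:E)%E)
  /\
  ((Linfty_norm u0 <= 1%:E)%E ->
   exists (N1 : nat) (C2 : R), 0 < C2 /\
     forall N : nat, (N1 <= N)%N ->
     forall u : R -> 'rV[R]_d -> R, galerkin_allen_cahn nu N u0 u ->
     (ereal_sup [set Linfty_norm (u t) | t in [set t : R | (0 <= t)%R]]
       <= Order.max (Linfty_norm (fproj N u0)) 1%:E
          + (N%:R `^ (- 2^-1) * C2)%:E)%E).
Proof.
have Npow (N : nat) (a b : R) : (0 < N)%N -> a <= b -> N%:R `^ a <= N%:R `^ b.
  by move=> N0 ab; apply: ler_powR => //; rewrite ler1n.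
have Ninv (N : nat) : (N%:R : R)^-1 = N%:R `^ (-1) by rewrite powR_inv1.
have u0_bounded : (Linfty_norm u0 <= 1%:E)%E -> ess_bounded u0 1.
  by move=> h; split => //; exact: Linfty_norm_le_ae.
have [E E0 hE] := @gac_effective_bound R d nu hd hnu.
have large (N : nat) : ((Num.truncn E).+1 <= N)%N -> (0 < N)%N /\ E < N%:R.
  move=> EN; split; first exact: leq_trans EN.
  by apply: lt_le_trans (truncnS_gt E) _; rewrite ler_nat.
split=> [/u0_bounded u01 s sd Hs|/u0_bounded u01].
  have [C C0 hC] := sobolev_fproj_sup ler01 u01 sd Hs.
  (* C comes from the Sobolev tail and E from the dynamics; gamma_0 is at most both exponents s -
     d/2 and 1, so N^(-gamma_0) dominates both errors. The 1 makes the constant positive. *)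
  exists (Num.truncn E).+1, (C + E + 1); split; first by rewrite ltr_wpDl// addr_ge0.
  move=> N /large[N0 EN] u sol; apply: sup_Linfty_norm_le => t x t0.
  have := hE _ _ _ _ N0 EN u01 sol (fun y => hC N y N0) t x t0.
  set g0 := Num.min _ _.
  have p0 : 0 <= C * N%:R `^ (- (s - d%:R / 2)) by rewrite mulr_ge0 ?powR_ge0.
  have p1 : C * N%:R `^ (- (s - d%:R / 2)) <= C * N%:R `^ (- g0).
    by rewrite ler_wpM2l// Npow// lerN2 ge_min lexx.
  have p2 : E / N%:R <= E * N%:R `^ (- g0).
    by rewrite ler_wpM2l// Ninv Npow// lerN2 ge_min lexx orbT.
  have p3 := powR_ge0 (N%:R : R) (- g0).
  rewrite (max_idPl _) ?lerDl//; lra.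
exists (Num.truncn E).+1, (E + 1); split; first by rewrite ltr_wpDl.
move=> N /large[N0 EN] u sol.
have Nge0 : (0 <= Linfty_norm (fproj N u0))%E by exact: Lnorm_ge0.
(* The norm is an extended real; if it were infinite, the claim would be trivial. *)
case EM : (Linfty_norm (fproj N u0)) Nge0 => [M| |]// M0; last first.
  by rewrite max_l ?leey// addye// leey.
rewrite lee_fin in M0.
have trig := trig_poly_fproj_any N ler01 u01.
have [_ _ [meas _]] := trig_poly_ess_bounded trig.
have projM : ess_bounded (fproj N u0) M.
  by split => //; apply: Linfty_norm_le_ae; rewrite EM.
rewrite -EFin_max -EFinD; apply: sup_Linfty_norm_le => t x t0.
have := hE _ _ _ _ N0 EN u01 sol (trig_poly_ess_bound M0 trig projM) t x t0.
have p2 : E / N%:R <= E * N%:R `^ (- 2^-1).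
  by rewrite ler_wpM2l// Ninv Npow//; lra.
have p3 := powR_ge0 (N%:R : R) (- 2^-1).
lra.
Qed.
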